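(* For every ensemble $D=\{D_\lambda\}\in\mathcal D_{\mathsf{PF\text{-}UNP}}$, every quantum polynomial-time oracle distinguisher $\mathcal D^{G,H}$ with single-bit output, every polynomially bounded $q$ and every family of $q(\lambda)$-qubit auxiliary states $\{\nu_\lambda\}$, $$\mathbb E_{G,H}\Big|\Pr[\mathcal D^{G,H}(\rho_{\lambda,G,H}\otimes\nu_\lambda)=1]-\Pr\big[\mathcal D^{G,H}\big(\tfrac{\mathds 1}{2^{m(\lambda)+\lambda}}\otimes\nu_\lambda\big)=1\big]\Big|\le\mathsf{negl}(\lambda),$$ where $\rho_{\lambda,G,H}=\mathbb E_{P_y\leftarrow D_\lambda}\mathbb E_{v\leftarrow\{0,1\}^{m(\lambda)}}|v^{G(y)}\rangle\langle v^{G(y)}|\otimes|H(v)\rangle\langle H(v)|$ is the averaged output of $\mathsf{CP.Protect}^{G,H}(1^\lambda,y)$. Consequently $\mathsf{CP.Protect}$ satisfies distributional indistinguishability in the QROM for $\mathcal D_{\mathsf{PF\text{-}UNP}}$, with the simulator that outputs the maximally mixed state on $m(\lambda)+\lambda$ qubits.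
   Context: $G:\{0,1\}^\lambda\to\{0,1\}^{m(\lambda)}$ and $H:\{0,1\}^{m(\lambda)}\to\{0,1\}^\lambda$ are uniformly random oracles (accessible in superposition) with $m(\lambda)>\lambda$ polynomially bounded. $|v^\theta\rangle=\bigotimes_i H^{\theta_i}|v_i\rangle$ (Hadamard $H$). $\mathsf{CP.Protect}(1^\lambda,y)$: $\theta=G(y)$, uniform $v\in\{0,1\}^{m(\lambda)}$, output $(|v^\theta\rangle,H(v))$. $\mathcal D_{\mathsf{PF\text{-}UNP}}$: ensembles $\{D_\lambda\}$ of distributions over point functions $P_y$ on $\{0,1\}^\lambda$ with $\mathbf H_{\min}(y)\ge\lambda^\epsilon$ for some $\epsilon>0$. *)

(* Defs.v *)
From HB Require Import structures.
From mathcomp Require Import all_boot all_order all_algebra complex.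
From mathcomp Require Import reals exp.
Set Implicit Arguments. Unset Strict Implicit. Unset Printing Implicit Defensive.
Import Order.TTheory GRing.Theory Num.Theory.
Local Open Scope ring_scope.
Local Open Scope complex_scope.

Definition bits (n : nat) := {ffun 'I_n -> bool}.

(** Computational-basis convention: basis state number a of a w-qubit
    register; qubit k holds bit k of a (little-endian). *)
Definition bitn (a k : nat) : bool := odd (a %/ 2 ^ k).

Definition of_bits (w : nat) (f : 'I_w -> bool) : nat :=
  (\sum_(k < w) (f k) * 2 ^ k)%N.

Section Quantum.
Context {R : realType}.
Local Notation C := R[i].

Definition adj n p (M : 'M[C]_(n, p)) : 'M[C]_(p, n) := (map_mx conjc M)^T.

Definition density n (M : 'M[C]_n) : Prop :=
  adj M = M /\ (forall u : 'cV[C]_n, 0 <= (adj u *m M *m u) 0 0) /\ \tr M = 1.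

Definition mxf n (M : 'M[C]_n) (i j : nat) : C :=
  match (insub i : option 'I_n), (insub j : option 'I_n) with
  | Some a, Some b => M a b
  | _, _ => 0
  end.

Definition isq2 : C := ((Num.sqrt (2 : R))^-1)%:C.

Definition perm_mat w (F : nat -> nat) : 'M[C]_(2 ^ w) :=
  \matrix_(a, b) (((a : nat) == F b)%N)%:R.

(** Gate set {Hadamard, T, CNOT} together with the two oracle gates
    U_G |x>|z> = |x>|z xor G(x)>  (x : l qubits, z : m qubits) and
    U_H |v>|z> = |v>|z xor H(v)>  (v : m qubits, z : l qubits),
    where the registers are given by maps into the w qubits. *)
Inductive instr (w l m : nat) : Type :=
| IHad of 'I_w
| IT of 'I_w
| ICNOT of 'I_w & 'I_w
| IqG of ('I_l -> 'I_w) & ('I_m -> 'I_w)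
| IqH of ('I_m -> 'I_w) & ('I_l -> 'I_w).


Definition instr_wf w l m (g : instr w l m) : Prop :=
  match g with
  | IHad _ | IT _ => True
  | ICNOT c t => c <> t
  | IqG xin zout =>
      injective (fun k : 'I_l + 'I_m => match k with inl i => xin i | inr j => zout j end)
  | IqH vin zout =>
      injective (fun k : 'I_m + 'I_l => match k with inl i => vin i | inr j => zout j end)
  end.

Definition oracle_map w a b (f : bits a -> bits b)
  (xin : 'I_a -> 'I_w) (zout : 'I_b -> 'I_w) (s : nat) : nat :=
  let x : bits a := [ffun i => bitn s (xin i)] in
  of_bits (fun k : 'I_w =>
    bitn s k (+) [exists j : 'I_b, (zout j == k) && f x j]).

Definition flip_bit (t s : nat) : nat :=
  if bitn s t then (s - 2 ^ t)%N else (s + 2 ^ t)%N.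

Definition gate_mat w l m (G : bits l -> bits m) (H : bits m -> bits l)
  (g : instr w l m) : 'M[C]_(2 ^ w) :=
  match g with
  | IHad k => \matrix_(a, b)
      (if [forall j : 'I_w, (j != k) ==> (bitn a j == bitn b j)]
       then (if bitn a k && bitn b k then - isq2 else isq2) else 0)
  | IT k => \matrix_(a, b)
      (if a == b then (if bitn a k then isq2 * (1 + 'i) else 1) else 0)
  | ICNOT c t => perm_mat w (fun s => if bitn s c then flip_bit t s else s)
  | IqG xin zout => perm_mat w (oracle_map G xin zout)
  | IqH vin zout => perm_mat w (oracle_map H vin zout)
  end.

Definition circ_mat w l m (G : bits l -> bits m) (H : bits m -> bits l)
  (c : seq (instr w l m)) : 'M[C]_(2 ^ w) :=
  foldl (fun U g => gate_mat G H g *m U) 1%:M c.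

(** Input state on w qubits: X on qubits [0, m+l), the auxiliary state nu
    on qubits [m+l, m+l+q), and |0...0> on the remaining work qubits. *)
Definition input_state w l m q (X : nat -> nat -> C) (nu : 'M[C]_(2 ^ q))
  : 'M[C]_(2 ^ w) :=
  \matrix_(a, b)
    (if ((a %/ 2 ^ (m + l + q) == 0) && (b %/ 2 ^ (m + l + q) == 0))%N
     then X (a %% 2 ^ (m + l))%N (b %% 2 ^ (m + l))%N
          * mxf nu ((a %/ 2 ^ (m + l)) %% 2 ^ q)%N ((b %/ 2 ^ (m + l)) %% 2 ^ q)%N
     else 0).

Definition accept_prob w (U rho : 'M[C]_(2 ^ w)) : R :=
  \sum_(a < 2 ^ w | bitn a 0) complex.Re ((U *m rho *m adj U) a a).

(** amplitude of  H^theta |v>  at basis bit a for one qubit *)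
Definition conj_amp (th v a : bool) : C :=
  if th then (if v && a then - isq2 else isq2) else (v == a)%:R.

(** amplitude of |v^theta> (x) |h>  at basis index a of m + l qubits *)
Definition cp_ket l m (theta : bits m) (v : bits m) (h : bits l) (a : nat) : C :=
  (\prod_(i < m) conj_amp (theta i) (v i) (bitn a i))
  * ([forall j : 'I_l, bitn a (m + j) == h j] && (a < 2 ^ (m + l))%N)%:R.

Definition rho_CP l m (D : {ffun bits l -> R}) (G : bits l -> bits m)
  (H : bits m -> bits l) (a b : nat) : C :=
  \sum_(y : bits l) (D y)%:C *
    ((2 ^ m)%:R^-1 * \sum_(v : bits m)
        cp_ket (G y) v (H v) a * conjc (cp_ket (G y) v (H v) b)).

Definition max_mixed l m (a b : nat) : C :=
  if (a == b) && (a < 2 ^ (m + l))%N then (2 ^ (m + l))%:R^-1 else 0.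

Definition avg_GH l m (F : {ffun bits l -> bits m} -> {ffun bits m -> bits l} -> R) : R :=
  (#|{ffun bits l -> bits m}|%:R * #|{ffun bits m -> bits l}|%:R)^-1 *
  \sum_(G : {ffun bits l -> bits m}) \sum_(H : {ffun bits m -> bits l}) F G H.

(** D_{PF-UNP}: ensembles of distributions on y (equivalently on point
    functions P_y) with min-entropy at least lambda^eps for some eps > 0 *)
Definition PF_UNP (D : forall l, {ffun bits l -> R}) : Prop :=
  (forall l y, 0 <= D l y) /\ (forall l, \sum_(y : bits l) D l y = 1) /\
  exists eps : R, 0 < eps /\
    forall l (y : bits l), D l y <= 2 `^ (- ((l%:R : R) `^ eps)).

Definition negligible (f : nat -> R) : Prop :=
  forall c : nat, exists N : nat, forall n : nat, (N <= n)%N ->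
    f n <= ((n%:R : R) ^+ c)^-1.

End Quantum.

Definition poly_bounded (f : nat -> nat) : Prop :=
  exists c : nat, forall n, (f n <= n ^ c + c)%N.

Fixpoint circ_wf w l m (c : seq (instr w l m)) : Prop :=
  match c with
  | [::] => True
  | g :: c' => instr_wf g /\ circ_wf c'
  end.

(* Main.v *)
Require Import Defs.
From HB Require Import structures.
From mathcomp Require Import all_boot all_order all_algebra complex.
From mathcomp Require Import reals sequences exp.
From mathcomp Require Import ring lra.
Set Implicit Arguments. Unset Strict Implicit. Unset Printing Implicit Defensive.
Import Order.TTheory GRing.Theory Num.Theory.
Local Open Scope ring_scope.

(** For a uniformly random function [F] and weights [mu] with small maximum,
    [\sum_x mu x * (c F x (F x) - E_y c F x y)] is small on average over [F] as
    soon as [c F x y] is insensitive to reprogramming [F] at a typical point: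
    resampling [F x] kills the off-diagonal terms of the second moment.  The
    second moment, rather than a hybrid of expectations, is what accommodates
    the absolute value inside [E_{G,H}].

    This is applied twice to the acceptance probability on [|v^th, h>].  First
    [F = G] and [mu = D]: the state [|v^th, H v>] with [th] in place of [G y]
    does not depend on [y], so the total query weight bounds the average weight
    on [y] by the number of queries times the largest value of [D].  Then
    [F = H] with uniform [mu]: with [th] averaged out, a query hits [v] with
    probability exponentially small in [m], because the averaged state
    [E_th |v^th><v^th|] is a tensor power of a qubit state of Frobenius norm
    [sqrt (3/4) <= 7/8].  Finally the average of [|v^th, h><v^th, h|] over
    [th], [v], [h] is maximally mixed.

    Every square root is replaced by the inequality [|z| <= eta + z^2 / eta]
    with a free parameter [eta], chosen as an inverse polynomial at the end. *)

(** * Averages and concentration for random functions *)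

Section Average.
Context {R : realType}.

Definition avg (T : finType) (f : T -> R) : R := #|T|%:R^-1 * \sum_t f t.

Lemma eq_avg (T : finType) (f g : T -> R) : f =1 g -> avg f = avg g.
Proof. by move=> fg; congr (_ * _); apply: eq_bigr. Qed.

Lemma ler_avg (T : finType) (f g : T -> R) :
  (forall t, f t <= g t) -> avg f <= avg g.
Proof.
by move=> fg; rewrite ler_wpM2l ?invr_ge0 ?ler0n// ler_sum.
Qed.

Lemma avg_cst (T : finType) (c : R) : (0 < #|T|)%N -> avg (fun _ : T => c) = c.
Proof.
move=> T0; rewrite /avg sumr_const -[c *+ _]mulr_natl mulKf//.
by rewrite pnatr_eq0 -lt0n.
Qed.

Lemma avg_ge0 (T : finType) (f : T -> R) : (forall t, 0 <= f t) -> 0 <= avg f.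
Proof. by move=> f0; rewrite mulr_ge0 ?invr_ge0 ?ler0n// sumr_ge0. Qed.

Lemma avg_le (T : finType) (f : T -> R) (c : R) :
  0 <= c -> (forall t, f t <= c) -> avg f <= c.
Proof.
move=> c0 fc; have [T0|] := posnP #|T|; last first.
  by move=> T0; rewrite -[leRHS](avg_cst c T0) ler_avg.
(* Over an empty type the average is [0]; this is where [0 <= c] enters. *)
by rewrite /avg T0 invr0 mul0r.
Qed.

Lemma avgD (T : finType) (f g : T -> R) :
  avg (fun t => f t + g t) = avg f + avg g.
Proof. by rewrite /avg big_split mulrDr. Qed.

Lemma avgB (T : finType) (f g : T -> R) :
  avg (fun t => f t - g t) = avg f - avg g.
Proof. by rewrite /avg sumrB mulrBr. Qed.

Lemma avgZ (T : finType) (c : R) (f : T -> R) :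
  avg (fun t => c * f t) = c * avg f.
Proof. by rewrite /avg -mulr_sumr mulrCA. Qed.

Lemma avg_sum (T I : finType) (f : T -> I -> R) :
  avg (fun t => \sum_i f t i) = \sum_i avg (f^~ i).
Proof. by rewrite /avg exchange_big mulr_sumr. Qed.

Lemma exchange_avg (S T : finType) (f : S -> T -> R) :
  avg (fun s => avg (f s)) = avg (fun t => avg (f^~ t)).
Proof.
by rewrite /avg -mulr_sumr exchange_big -[in RHS]mulr_sumr mulrCA.
Qed.

Lemma ler_norm_avg (T : finType) (f : T -> R) :
  `|avg f| <= avg (fun t => `|f t|).
Proof.
rewrite /avg normrM ger0_norm ?invr_ge0 ?ler0n//.
by rewrite ler_wpM2l ?invr_ge0 ?ler0n// ler_norm_sum.
Qed.

End Average.

Section Concentration.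
Context {R : realType}.

Definition upd (X Y : finType) (F : {ffun X -> Y}) (x : X) (y : Y) :
  {ffun X -> Y} := [ffun z => if z == x then y else F z].

(* [(F, y) |-> (upd F x y, F x)] is an involution. *)
Lemma avg_resample (X Y : finType) (x : X) (Phi : {ffun X -> Y} -> Y -> R) :
  (0 < #|Y|)%N ->
  avg (fun F : {ffun X -> Y} => Phi F (F x)) =
  avg (fun F : {ffun X -> Y} => avg (fun y => Phi (upd F x y) y)).
Proof.
move=> Y0; transitivity (avg (fun F : {ffun X -> Y} => avg (fun _ : Y => Phi F (F x)))).
  by apply: eq_avg => F; rewrite avg_cst.
rewrite /avg -!mulr_sumr; congr (_ * (_ * _)).
rewrite !pair_big/=.
pose h (p : {ffun X -> Y} * Y) := (upd p.1 x p.2, p.1 x).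
have hK : involutive h.
  move=> [F y]; rewrite /h/= ffunE eqxx; congr (_, _).
  by apply/ffunP => z; rewrite !ffunE; case: eqP => // ->.
rewrite (reindex_inj (inv_inj hK))/=.
by apply: eq_bigr => -[F y] _ /=; rewrite ffunE eqxx.
Qed.

(** From [p * q - r * s = (p - r) * q + r * (q - s)]. It lets both factors of a correlation be moved
    back to the unperturbed function. *)
Lemma prod_diff_le (p q r s : R) :
  `|q| <= 1 -> `|r| <= 1 -> p * q <= r * s + `|p - r| + `|q - s|.
Proof.
move=> q1 r1; rewrite -lerBlDl.
have -> : p * q - (r * s + `|p - r|) = (p - r) * q - `|p - r| + r * (q - s) by ring.
rewrite -[leRHS]add0r lerD//.
  rewrite subr_le0 (le_trans (ler_norm _))// normrM ler_piMr//.
by rewrite (le_trans (ler_norm _))// normrM ler_piMl.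
Qed.

Lemma norm_le_amgm (eta z : R) : 0 < eta -> `|z| <= eta + z ^+ 2 / eta.
Proof.
move=> e0; have [|/ltW h] := leP `|z| eta.
  by move=> /le_trans; apply; rewrite lerDl divr_ge0 ?sqr_ge0 ?ltW.
rewrite -[leLHS]add0r lerD//; first exact: ltW.
rewrite ler_pdivlMr// -real_normK ?num_real// expr2.
by rewrite ler_wpM2l.
Qed.

Section Moments.
Variables (X Y : finType) (mu : X -> R).
Variables (kap : R).
Hypothesis Y0 : (0 < #|Y|)%N.
Hypothesis mu0 : forall x, 0 <= mu x.
Hypothesis mu1 : \sum_x mu x = 1.
Hypothesis mukap : forall x, mu x <= kap.

(** Expand the square into pairs [x], [x']. The diagonal costs at most [\sum_x mu x ^+ 2 <= kap].
    Off the diagonal, replace [F x] by a fresh [y]: up to the errors [e] in the two factors, the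
    product becomes [b F x y * b F x' (F x')], whose mean over [y] is zero. The two smallness
    hypotheses control the error in the factor at [x] itself and in the factor at a fixed [x']. *)
Lemma second_moment (del : R) (b : {ffun X -> Y} -> X -> Y -> R)
    (e : {ffun X -> Y} -> X -> X -> Y -> R) :
  (forall F x y, `|b F x y| <= 1) ->
  (forall F x, avg (b F x) = 0) ->
  (forall F x y x' y', `|b (upd F x y) x' y' - b F x' y'| <= e F x x' y') ->
  (forall F y, \sum_x mu x * e F x x y <= del) ->
  (forall F x' y', \sum_x mu x * e F x x' y' <= del) ->
  avg (fun F : {ffun X -> Y} => (\sum_x mu x * b F x (F x)) ^+ 2) <= kap + 2 * del.
Proof.
move=> b1 bavg be ed ed'.
have e0 F x x' y' : 0 <= e F x x' y'.
  have /card_gt0P[y _] := Y0.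
  by apply: le_trans (be F x y x' y').
have F0 : (0 < #|{ffun X -> Y}|)%N by rewrite card_ffun expn_gt0 Y0.
pose er x x' := avg (fun F : {ffun X -> Y} => avg (e F x x)) +
                avg (fun F : {ffun X -> Y} => e F x x' (F x')).
have er0 x x' : 0 <= er x x' by rewrite addr_ge0// avg_ge0// => F; rewrite ?avg_ge0.
have key x x' : avg (fun F : {ffun X -> Y} => b F x (F x) * b F x' (F x')) <=
    (x == x')%:R + er x x'.
  have [<-|xx'] := eqVneq x x'.
    apply: ler_wpDr => //; apply: avg_le => // F.
    rewrite (le_trans (ler_norm _))// normrM.
    by rewrite mulr_ile1.
  rewrite (avg_resample x (fun F y => b F x y * b F x' (F x')))// add0r.
  have le1 (F : {ffun X -> Y}) y : b (upd F x y) x y * b (upd F x y) x' (upd F x y x') <=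
      b F x y * b F x' (F x') + e F x x y + e F x x' (F x').
    rewrite [upd _ _ _ x']ffunE [x' == x]eq_sym (negbTE xx').
    by apply: le_trans (prod_diff_le _ _ _ _) _; rewrite ?lerD.
  apply: le_trans (ler_avg (fun F => ler_avg (le1 F))) _.
  rewrite le_eqVlt; apply/orP; left; apply/eqP.
  rewrite /er -avgD; apply: eq_avg => F.
  rewrite !avgD avg_cst//; congr (_ + _).
  rewrite -[RHS]add0r; congr (_ + _).
  (* [b F x' (F x')] is constant in the fresh value [y], so the centring hypothesis [bavg]
     annihilates this term. *)
  under eq_avg do rewrite mulrC.
  by rewrite avgZ bavg mulr0.
have -> : avg (fun F : {ffun X -> Y} => (\sum_x mu x * b F x (F x)) ^+ 2) =
   \sum_x \sum_x' mu x * mu x' * avg (fun F : {ffun X -> Y} => b F x (F x) * b F x' (F x')).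
  under eq_bigr do under eq_bigr do rewrite -avgZ.
  under eq_bigr do rewrite -avg_sum.
  rewrite -avg_sum; apply: eq_avg => F.
  rewrite expr2 mulr_suml; apply: eq_bigr => x _; rewrite mulr_sumr.
  by apply: eq_bigr => x' _; rewrite mulrACA.
have -> : kap + 2 * del = kap + (del + del) by ring.
apply: (@le_trans _ _ (\sum_x \sum_x' mu x * mu x' * ((x == x')%:R + er x x'))).
  by apply: ler_sum => x _; apply: ler_sum => x' _; rewrite ler_wpM2l ?mulr_ge0.
under eq_bigr do under eq_bigr do rewrite mulrDr.
under eq_bigr do rewrite big_split/=.
rewrite big_split/= lerD//.
  have -> : kap = \sum_x mu x * kap by rewrite -mulr_suml mu1 mul1r.
  apply: ler_sum => x _.
  rewrite (bigD1 x)//= eqxx mulr1 big1 ?addr0 ?ler_wpM2l//.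
  by move=> x' x'x; rewrite eq_sym (negbTE x'x) mulr0.
under eq_bigr do under eq_bigr do rewrite mulrDr.
under eq_bigr do rewrite big_split/=.
rewrite big_split/= lerD//.
  have -> : \sum_x \sum_x' mu x * mu x' * avg (fun F : {ffun X -> Y} => avg (e F x x)) =
      avg (fun F : {ffun X -> Y} => avg (fun y => \sum_x mu x * e F x x y)).
    under eq_bigr => x _ do rewrite -mulr_suml -mulr_sumr mu1 mulr1 -avgZ.
    rewrite -avg_sum; apply: eq_avg => F.
    by under eq_bigr do rewrite -avgZ; rewrite -avg_sum.
  have /card_gt0P[F _] := F0; have /card_gt0P[y _] := Y0.
  have d0 : 0 <= del.
    by apply: le_trans (ed F y); apply: sumr_ge0 => x _; rewrite mulr_ge0.
  by apply: avg_le => // F'; apply: avg_le.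
have -> : del = \sum_x mu x * del by rewrite -mulr_suml mu1 mul1r.
(* Here the reprogrammed point [x] is summed first, with [x'] and [F x'] fixed. *)
rewrite exchange_big/=; apply: ler_sum => x' _.
under eq_bigr do rewrite mulrAC -avgZ mulrC.
rewrite -mulr_sumr ler_wpM2l// -avg_sum.
have /card_gt0P[F _] := F0; have /card_gt0P[y _] := Y0.
have d0 : 0 <= del.
  by apply: le_trans (ed F y); apply: sumr_ge0 => x _; rewrite mulr_ge0.
by apply: avg_le.
Qed.

Lemma oracle_concentration (del : R) (c : {ffun X -> Y} -> X -> Y -> R)
    (e : {ffun X -> Y} -> X -> X -> Y -> R) (eta : R) :
  0 < eta ->
  (forall F x y, 0 <= c F x y <= 1) ->
  (forall F x y x' y', `|c (upd F x y) x' y' - c F x' y'| <= e F x x' y') ->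
  (forall F y, \sum_x mu x * e F x x y <= del) ->
  (forall F x' y', \sum_x mu x * e F x x' y' <= del) ->
  avg (fun F : {ffun X -> Y} => `|\sum_x mu x * (c F x (F x) - avg (c F x))|)
    <= eta + (kap + 4 * del) / eta.
Proof.
move=> eta0 c01 ce ed ed'.
have c0 F x y : 0 <= c F x y by case/andP: (c01 F x y).
have c1 F x y : c F x y <= 1 by case/andP: (c01 F x y).
have F0 : (0 < #|{ffun X -> Y}|)%N by rewrite card_ffun expn_gt0 Y0.
have e0 F x x' y' : 0 <= e F x x' y'.
  have /card_gt0P[y _] := Y0.
  by apply: le_trans (ce F x y x' y').
have /card_gt0P[F1 _] := F0; have /card_gt0P[y1 _] := Y0.
have d0 : 0 <= del.
  by apply: le_trans (ed F1 y1); apply: sumr_ge0 => x _; rewrite mulr_ge0.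
apply: le_trans (ler_avg (fun F => norm_le_amgm _ eta0)) _.
rewrite avgD avg_cst// lerD//.
under eq_avg do rewrite mulrC.
rewrite avgZ mulrC; apply: ler_wpM2r; first by rewrite invr_ge0 ltW.
(* Centring [c] perturbs both [c] and its mean, which doubles [del] and turns [2 * del] into
   [4 * del]. *)
pose e' F x x' y' := e F x x' y' + avg (e F x x').
have -> : kap + 4 * del = kap + 2 * (del + del) by ring.
apply: (@second_moment (del + del) (fun F x y => c F x y - avg (c F x)) e').
- move=> F x y; have a0 : 0 <= avg (c F x) by exact: avg_ge0.
  have a1 : avg (c F x) <= 1 by apply: avg_le => //; rewrite ler01.
  rewrite ler_norml; have := c0 F x y; have := c1 F x y; lra.
- by move=> F x; rewrite avgB avg_cst// subrr.
- move=> F x y x' y'; rewrite /e'.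
  have -> : c (upd F x y) x' y' - avg (c (upd F x y) x') - (c F x' y' - avg (c F x')) =
    (c (upd F x y) x' y' - c F x' y') - (avg (c (upd F x y) x') - avg (c F x')) by ring.
  apply: le_trans (ler_normB _ _) _; rewrite lerD// -avgB.
  by apply: le_trans (ler_norm_avg _) _; apply: ler_avg.
- move=> F y; under eq_bigr do rewrite mulrDr.
  rewrite big_split/= lerD//; under eq_bigr do rewrite -avgZ.
  by rewrite -avg_sum; apply: avg_le.
- move=> F x' y'; under eq_bigr do rewrite mulrDr.
  rewrite big_split/= lerD//; under eq_bigr do rewrite -avgZ.
  by rewrite -avg_sum; apply: avg_le.
Qed.
End Moments.
End Concentration.

(** * Bit strings and unitarity of the gates *)

Section Bits.
Local Open Scope nat_scope.

Lemma bitn0 a : bitn a 0 = odd a.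
Proof. by rewrite /bitn expn0 divn1. Qed.

Lemma bitnS a k : bitn a k.+1 = bitn a./2 k.
Proof. by rewrite /bitn expnS divnMA divn2. Qed.

Lemma of_bitsS w (f : 'I_w.+1 -> bool) :
  of_bits f = f ord0 + (of_bits (fun k : 'I_w => f (lift ord0 k))).*2.
Proof.
rewrite /of_bits big_ord_recl expn0 muln1; congr (_ + _).
rewrite -muln2 big_distrl/=; apply: eq_bigr => i _.
by rewrite /bump/= add1n expnSr mulnA.
Qed.

Lemma of_bits_lt w (f : 'I_w -> bool) : of_bits f < 2 ^ w.
Proof.
elim: w f => [|w IH] f; first by rewrite /of_bits big_ord0.
rewrite of_bitsS expnS mul2n; have := IH (fun k => f (lift ord0 k)).
rewrite -ltn_double => h; apply: leq_trans _ (_ : (of_bits (fun k => f (lift ord0 k))).+1.*2 <= _).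
  by rewrite doubleS !ltnS; case: (f ord0).
by rewrite leq_double IH.
Qed.

Lemma bitn_of_bits w (f : 'I_w -> bool) (k : 'I_w) : bitn (of_bits f) k = f k.
Proof.
elim: w f k => [|w IH] f; first by case.
move=> k; rewrite of_bitsS; case: (unliftP ord0 k) => [j ->|->].
  by rewrite lift0 bitnS half_bit_double (IH (fun k => f (lift ord0 k))).
by rewrite bitn0 oddD odd_double addbF; case: (f ord0).
Qed.

Lemma bitnK w s : s < 2 ^ w -> of_bits (fun k : 'I_w => bitn s k) = s.
Proof.
elim: w s => [|w IH] s.
  by rewrite expn0 ltnS leqn0 => /eqP ->; rewrite /of_bits big_ord0.
move=> sw; rewrite of_bitsS -[RHS]odd_double_half bitn0; congr (_ + _.*2).
rewrite -[RHS](IH s./2); last by rewrite -divn2 ltn_divLR// -expnSr.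
by apply: eq_bigr => k _; rewrite lift0 bitnS.
Qed.

Lemma bitn_inj w s t : s < 2 ^ w -> t < 2 ^ w ->
  (forall k : 'I_w, bitn s k = bitn t k) -> s = t.
Proof.
move=> sw tw st; rewrite -(bitnK sw) -(bitnK tw).
by apply: eq_bigr => k _; rewrite st.
Qed.

(** Brings CNOT to the xor form that [of_bits_involution] handles. *)
Lemma flip_bitE w s (t : 'I_w) : s < 2 ^ w ->
  flip_bit t s = of_bits (fun k : 'I_w => bitn s k (+) (k == t)).
Proof.
move=> sw; rewrite /flip_bit -{2 3}(bitnK sw) /of_bits.
rewrite (bigD1 t)//= [RHS](bigD1 t)//= eqxx.
rewrite [X in _ = _ + X](eq_bigr (fun k : 'I_w => bitn s k * 2 ^ k)).
  by case: (bitn s t); rewrite ?mul1n ?mul0n ?add0n ?addKn// addnC.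
by move=> k /negbTE ->; rewrite addbF.
Qed.

Definition ord_of_bits w (x : bits w) : 'I_(2 ^ w) := Ordinal (of_bits_lt x).

Lemma ord_of_bits_bij w : bijective (@ord_of_bits w).
Proof.
exists (fun a : 'I_(2 ^ w) => [ffun k : 'I_w => bitn a k] : bits w).
  by move=> x; apply/ffunP => k; rewrite ffunE bitn_of_bits.
move=> a; apply: val_inj => /=; rewrite -[RHS](bitnK (ltn_ord a)).
by apply: eq_bigr => k _; rewrite ffunE.
Qed.

Lemma card_bits n : #|{: bits n}| = 2 ^ n.
Proof. by rewrite card_ffun card_bool card_ord. Qed.

Lemma bits_gt0 n : 0 < #|{: bits n}|.
Proof. by rewrite card_bits expn_gt0. Qed.
End Bits.

Lemma sum_bits (V : nmodType) w (F : nat -> V) :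
  \sum_(a < 2 ^ w) F a = \sum_(x : bits w) F (of_bits x).
Proof. by rewrite (reindex _ (onW_bij _ (ord_of_bits_bij w))). Qed.

Section Isometry.
Context {R : realType}.
Local Notation C := R[i].

Definition sqn (z : C) : R := complex.Re z ^+ 2 + complex.Im z ^+ 2.

Definition nrm2 n (u : 'cV[C]_n) : R := \sum_a sqn (u a 0).

Lemma sqn_ge0 z : 0 <= sqn z.
Proof. by rewrite addr_ge0 ?sqr_ge0. Qed.

Lemma sqn0 : sqn 0 = 0.
Proof. by rewrite /sqn /= expr0n addr0. Qed.

Lemma sqnM y z : sqn (y * z) = sqn y * sqn z.
Proof. by case: y z => [a b] [c d]; rewrite /sqn /=; ring. Qed.

Lemma sqn_prod (I : finType) (F : I -> C) : sqn (\prod_i F i) = \prod_i sqn (F i).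
Proof.
apply: (big_morph sqn); first exact: sqnM.
by rewrite /sqn /=; ring.
Qed.

Lemma mul_conjc z : z * conjc z = (sqn z)%:C%C.
Proof. by case: z => a b; apply/eqP; rewrite eq_complex /sqn /=; apply/andP; split; apply/eqP; ring. Qed.

Lemma nrm2E n (u : 'cV[C]_n) : (adj u *m u) 0 0 = (nrm2 u)%:C%C.
Proof.
rewrite mxE /nrm2 (rmorph_sum (real_complex R)); apply: eq_bigr => a _.
by rewrite !mxE mulrC mul_conjc.
Qed.

Definition isometry n (M : 'M[C]_n) : Prop := adj M *m M = 1%:M.

Lemma adjE n p (M : 'M[C]_(n, p)) i j : adj M i j = conjc (M j i).
Proof. by rewrite !mxE. Qed.

Lemma adjM n p q (A : 'M[C]_(n, p)) (B : 'M[C]_(p, q)) :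
  adj (A *m B) = adj B *m adj A.
Proof. by rewrite /adj map_mxM trmx_mul. Qed.

Lemma nrm2_isometry n (M : 'M[C]_n) (u : 'cV[C]_n) :
  isometry M -> nrm2 (M *m u) = nrm2 u.
Proof.
move=> iM; apply: (@complexI R); rewrite -!nrm2E adjM mulmxA -(mulmxA (adj u)).
by rewrite iM mulmx1.
Qed.

Lemma isq2_sqr : isq2 * isq2 + isq2 * isq2 = 1 :> C.
Proof.
rewrite /isq2 -!rmorphM/= -rmorphD/= -invfM -expr2 sqr_sqrtr ?ler0n//.
rewrite -[RHS](rmorph1 (real_complex R)); congr (_%:C)%C.
by rewrite -mulr2n -[_ *+ 2]mulr_natl divff// pnatr_eq0.
Qed.

Lemma conj_amp_real th v a : conjc (conj_amp th v a) = conj_amp th v a :> C.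
Proof.
rewrite /conj_amp /isq2; case: th; last by rewrite rmorph_nat.
by case: ifP => _; rewrite ?rmorphN/= oppr0.
Qed.

Lemma conj_ampC th v a : conj_amp th v a = conj_amp th a v :> C.
Proof. by rewrite /conj_amp andbC eq_sym. Qed.

Lemma conj_amp_orth th v v' :
  \sum_(x : bool) conj_amp th v x * conj_amp th v' x = (v == v')%:R :> C.
Proof.
have h := isq2_sqr; rewrite big_bool /conj_amp.
by case: th; case: v; case: v'; rewrite /= ?mulrNN ?mulNr ?mulrN ?h ?addNr ?subrr ?mulr0 ?mul0r ?addr0 ?add0r ?mulr1.
Qed.

(** An entry of the tensor product of the Hadamard powers [th i]. It covers the conjugate coding
    states and, with [th] the indicator of one qubit, the Hadamard gate on that qubit. *)
Definition amp n (th v x : 'I_n -> bool) : C := \prod_i conj_amp (th i) (v i) (x i).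

Lemma amp_real n (th v x : 'I_n -> bool) : conjc (amp th v x) = amp th v x.
Proof. by rewrite /amp rmorph_prod; apply: eq_bigr => i _; exact: conj_amp_real. Qed.

Lemma ampC n (th v x : 'I_n -> bool) : amp th v x = amp th x v.
Proof. by apply: eq_bigr => i _; exact: conj_ampC. Qed.

(** The sum over strings factors into one-qubit sums, each an orthogonality relation. *)
Lemma amp_orth n (th v v' : 'I_n -> bool) :
  \sum_(x : bits n) amp th v x * amp th v' x = [forall i, v i == v' i]%:R.
Proof.
under eq_bigr do rewrite /amp -big_split/=.
rewrite -(bigA_distr_bigA (fun i a => conj_amp (th i) (v i) a * conj_amp (th i) (v' i) a)).
under eq_bigr do rewrite conj_amp_orth.
have [/forallP h|/forallPn[i vi]] := boolP [forall i, v i == v' i].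
  by rewrite big1// => i _; rewrite h.
by rewrite (bigD1 i)//= (negbTE vi) mul0r.
Qed.

Lemma perm_mat_isometry w (F : nat -> nat) :
  (forall s, (s < 2 ^ w)%N -> (F s < 2 ^ w)%N) ->
  (forall s, (s < 2 ^ w)%N -> F (F s) = s) ->
  isometry (perm_mat w F : 'M[C]_(2 ^ w)).
Proof.
move=> Fw FF; apply/matrixP => a b; rewrite !mxE.
rewrite (bigD1 (Ordinal (Fw a (ltn_ord a))))//= big1 ?addr0.
  rewrite !mxE/= eqxx rmorph_nat mul1r; congr (_%:R); congr (nat_of_bool _).
  apply/eqP/eqP => [|->//] /(congr1 F); rewrite !FF//; exact: val_inj.
move=> i ia; rewrite !mxE.
have /negbTE -> : (nat_of_ord i != F a)%N by apply: contraNN ia => /eqP h; apply/eqP/val_inj.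
by rewrite rmorph0 mul0r.
Qed.

Lemma of_bits_involution w (phi : nat -> 'I_w -> bool) (F := fun s => of_bits (phi s)) :
  (forall s, (s < 2 ^ w)%N -> forall k, phi (F s) k = bitn s k) ->
  isometry (perm_mat w F : 'M[C]_(2 ^ w)).
Proof.
move=> h; apply: perm_mat_isometry => s sw; first exact: of_bits_lt.
by rewrite -[RHS](bitnK sw); apply: eq_bigr => k _; rewrite h.
Qed.

(** As the registers are disjoint, the query leaves its input intact, so a second query xors in the
    same value and undoes the first. *)
Lemma oracle_map_isometry w a b (f : bits a -> bits b) (xin : 'I_a -> 'I_w)
    (zout : 'I_b -> 'I_w) :
  (forall i j, xin i <> zout j) ->
  isometry (perm_mat w (oracle_map f xin zout) : 'M[C]_(2 ^ w)).
Proof.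
move=> xz; apply: of_bits_involution => s sw k.
set x : bits a := [ffun i => bitn s (xin i)]; set x' : bits a := [ffun i => _].
have -> : x' = x.
  apply/ffunP => i; rewrite [LHS]ffunE [RHS]ffunE bitn_of_bits.
  have /negbTE -> : ~~ [exists j, (zout j == xin i) && f x j]; last by rewrite addbF.
  by apply/existsPn => j; apply/nandP; left; apply/eqP => /esym; exact: xz.
by rewrite bitn_of_bits -addbA addbb addbF.
Qed.

Lemma had_matE w l m (G : bits l -> bits m) (H : bits m -> bits l) (k : 'I_w) a b :
  gate_mat G H (IHad l m k) a b = amp (fun j => j == k) (bitn b) (bitn a) :> C.
Proof.
rewrite mxE /amp (bigD1 k)//= eqxx /conj_amp/= andbC.
case: forallP => h.
  rewrite [X in _ * X]big1 ?mulr1// => j jk.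
  by rewrite (negbTE jk); have := h j; rewrite jk/= eq_sym => ->.
have /forallPn[j] : ~~ [forall j : 'I_w, (j != k) ==> (bitn a j == bitn b j)].
  by apply/forallP.
rewrite negb_imply => /andP[jk ab].
by rewrite [X in _ * X](bigD1 j)//= (negbTE jk) eq_sym (negbTE ab) mul0r mulr0.
Qed.

(** Hadamard reduces to [amp_orth], T is diagonal with entries of modulus one, and the other gates
    are involutive permutations of the basis. *)
Lemma gate_isometry w l m (G : bits l -> bits m) (H : bits m -> bits l)
    (g : instr w l m) : instr_wf g -> isometry (gate_mat G H g : 'M[C]_(2 ^ w)).
Proof.
case: g => [k|k|c t|xin zout|vin zout] wf.
- apply/matrixP => a b; rewrite mxE [RHS]mxE.
  under eq_bigr do rewrite adjE !had_matE amp_real.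
  rewrite (sum_bits _ (fun c => amp _ (bitn a) (fun i : 'I_w => bitn c i) * amp _ (bitn b) (fun i : 'I_w => bitn c i))).
  under eq_bigr do rewrite /amp; rewrite (eq_bigr (fun x : bits w =>
    amp (fun j => j == k) (bitn a) x * amp (fun j => j == k) (bitn b) x)).
    rewrite amp_orth; congr (_%:R); congr (nat_of_bool _).
    apply/forallP/eqP => [h|->//].
    by apply: val_inj; apply: (bitn_inj (ltn_ord a) (ltn_ord b)) => i; apply/eqP.
  by move=> x _; congr (_ * _); apply: eq_bigr => i _; rewrite bitn_of_bits.
- rewrite /=; apply/matrixP => a b; rewrite !mxE (bigD1 a)//= big1 ?addr0.
    rewrite !mxE eqxx; case: eqP => [->|_]; last by rewrite mulr0.
    case: ifP => _; last by rewrite rmorph1 mulr1.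
    rewrite mulrC mul_conjc sqnM.
    have -> : sqn (1 + 'i%C : C) = 1 + 1 by rewrite /sqn /=; ring.
    rewrite mulrDr mulr1 rmorphD/= -mul_conjc -[RHS]isq2_sqr.
    by rewrite [in conjc _]/isq2 conjc_real.
  by move=> i /negbTE ia; rewrite !mxE ia rmorph0 mul0r.
- pose phi s (k : 'I_w) := bitn s k (+) (bitn s c && (k == t)).
  rewrite /= in wf *.
  have e : (perm_mat w (fun s => if bitn s c then flip_bit t s else s) : 'M[C]_(2 ^ w)) =
      perm_mat w (fun s => of_bits (phi s)).
    apply/matrixP => a b; rewrite !mxE; congr (_%:R); congr (nat_of_bool _); congr (_ == _).
    rewrite /phi; case: (bitn b c); first by rewrite flip_bitE.
    by rewrite -[LHS](bitnK (ltn_ord b)); apply: eq_bigr => i _; rewrite addbF.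
  rewrite e; apply: of_bits_involution => s sw k.
  rewrite {1}/phi !bitn_of_bits /phi.
  have /negbTE -> : c != t by apply/eqP.
  by rewrite andbF addbF -addbA addbb addbF.
- apply: oracle_map_isometry => i j h.
  by have := wf (inl i) (inr j) h.
- apply: oracle_map_isometry => i j h.
  by have := wf (inl i) (inr j) h.
Qed.

End Isometry.

(** * Query weights, oracle reprogramming and guessing *)

Section Hybrid.
Context {R : realType}.
Local Notation C := R[i].

Lemma sqnN (z : C) : sqn (- z) = sqn z.
Proof. by case: z => a b; rewrite /sqn /= !sqrrN. Qed.

Lemma sqnD_le (y z : C) : sqn (y + z) <= 2 * sqn y + 2 * sqn z.
Proof.
case: y z => [a b] [c d]; rewrite /sqn /=.
have := sqr_ge0 (a - c); have := sqr_ge0 (b - d); nra.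
Qed.

(** Factor the difference of squares as [(a - c) * (a + c)], apply weighted AM-GM, and use
    [(a + c) ^+ 2 <= 2 * (a ^+ 2 + c ^+ 2)]. *)
Lemma sqr_diff_le (a c eta : R) : 0 < eta ->
  `|a ^+ 2 - c ^+ 2| <= (a - c) ^+ 2 / eta + eta / 2 * (a ^+ 2 + c ^+ 2).
Proof.
move=> e0; set s := (a - c) / eta.
have ac : a = c + eta * s by rewrite /s mulrC divfK ?gt_eqF// addrC subrK.
have -> : (a - c) ^+ 2 / eta = eta * s ^+ 2 by rewrite /s; field; rewrite gt_eqF.
have -> : a ^+ 2 - c ^+ 2 = eta * (s * (a + c)) by rewrite subr_sqr ac; ring.
have -> : eta * s ^+ 2 + eta / 2 * (a ^+ 2 + c ^+ 2) = eta * (s ^+ 2 + (a ^+ 2 + c ^+ 2) / 2) by field.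
rewrite normrM gtr0_norm// ler_wpM2l ?(ltW e0)//.
rewrite ler_norml; have := sqr_ge0 (s + (a + c) / 2); have := sqr_ge0 (s - (a + c) / 2).
have := sqr_ge0 (a - c); nra.
Qed.

Lemma sqn_diff_le (y z : C) (eta : R) : 0 < eta ->
  `|sqn y - sqn z| <= sqn (y - z) / eta + eta / 2 * (sqn y + sqn z).
Proof.
case: y z => [a b] [c d] e0; rewrite /sqn /=.
have := sqr_diff_le a c e0; have := sqr_diff_le b d e0.
set A := a ^+ 2; set B := b ^+ 2; set A' := c ^+ 2; set B' := d ^+ 2 => h1 h2.
have -> : A + B - (A' + B') = (A - A') + (B - B') by ring.
apply: le_trans (ler_normD _ _) _; apply: le_trans (lerD h2 h1) _.
by rewrite mulrDl le_eqVlt; apply/orP; left; apply/eqP; ring.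
Qed.

(** The probability that measuring qubit [0] of the pure state [u] yields one. *)
Definition acc w (u : 'cV[C]_(2 ^ w)) : R := \sum_(a < 2 ^ w | bitn a 0) sqn (u a 0).

Lemma acc_ge0 w (u : 'cV[C]_(2 ^ w)) : 0 <= acc u.
Proof. by apply: sumr_ge0 => a _; exact: sqn_ge0. Qed.

Lemma acc_le_nrm2 w (u : 'cV[C]_(2 ^ w)) : acc u <= nrm2 u.
Proof. rewrite /acc big_mkcond; apply: ler_sum => a _.
by case: ifP => // _; exact: sqn_ge0. Qed.

Lemma acc_diff_le w (y z : 'cV[C]_(2 ^ w)) (eta : R) : 0 < eta ->
  `|acc y - acc z| <= nrm2 (y - z) / eta + eta / 2 * (nrm2 y + nrm2 z).
Proof.
move=> e0; rewrite /acc -sumrB; apply: le_trans (ler_norm_sum _ _ _) _.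
apply: (@le_trans _ _ (\sum_a `|sqn (y a 0) - sqn (z a 0)|)).
  rewrite big_mkcond; apply: ler_sum => a _.
  by case: ifP.
rewrite /nrm2 -big_split/= mulr_suml mulr_sumr -big_split/=.
by apply: ler_sum => a _; rewrite !mxE; exact: sqn_diff_le.
Qed.

Lemma nrm2B_le n (y z : 'cV[C]_n) : nrm2 (y - z) <= 2 * nrm2 y + 2 * nrm2 z.
Proof.
rewrite /nrm2 !mulr_sumr -big_split/=; apply: ler_sum => a _.
by rewrite !mxE (le_trans (sqnD_le _ _))// sqnN.
Qed.

Section Run.
Variables (w l m : nat).
Implicit Types (G : bits l -> bits m) (H : bits m -> bits l).
Implicit Types (g : instr w l m) (c : seq (instr w l m)) (u : 'cV[C]_(2 ^ w)).

Definition run G H c u := foldl (fun u g => gate_mat G H g *m u) u c.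

Lemma circ_mat_run G H c u : circ_mat G H c *m u = run G H c u.
Proof.
rewrite /circ_mat /run -[in RHS](mul1mx u).
elim: c 1%:M => [//|g c IH] U /=.
by rewrite IH mulmxA.
Qed.

Lemma nrm2_run G H c u : circ_wf c -> nrm2 (run G H c u) = nrm2 u.
Proof.
elim: c u => [//|g c IH] u /= [wg wc].
by rewrite IH// nrm2_isometry//; exact: gate_isometry.
Qed.

Lemma runB G H c u v : run G H c (u - v) = run G H c u - run G H c v.
Proof. by rewrite -!circ_mat_run mulmxBr. Qed.

Variables (X : finType) (reg : instr w l m -> nat -> option X).

(** Query magnitude: [reg g a] stands for the point that [g] queries on basis state [a], or [None]
    if [g] makes no query to the oracle in question. Leaving [reg] abstract serves both oracles. *)
Definition gweight g u (x : X) : R := \sum_(a < 2 ^ w | reg g a == Some x) sqn (u a 0).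

Fixpoint qweight G H c u (x : X) : R :=
  if c is g :: c' then gweight g u x + qweight G H c' (gate_mat G H g *m u) x else 0.

Lemma qweight_ge0 G H c u x : 0 <= qweight G H c u x.
Proof.
elim: c u => //= g c IH u; rewrite addr_ge0//.
by apply: sumr_ge0 => a _; exact: sqn_ge0.
Qed.

(** A basis state determines at most one queried point, so each [a] is counted at most once. *)
Lemma sum_reg_le (f : X -> 'I_(2 ^ w) -> R) (f' : 'I_(2 ^ w) -> R) g :
  (forall a, 0 <= f' a) -> (forall x a, f x a <= f' a) ->
  \sum_x \sum_(a < 2 ^ w | reg g a == Some x) f x a <= \sum_a f' a.
Proof.
move=> f0 ff; rewrite (exchange_big_dep predT)//=; apply: ler_sum => a _.
case: (reg g a) => [y|]; last by rewrite big_pred0.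
by rewrite (big_pred1 y) => [//|x]; apply/eqP/eqP => [[]|->].
Qed.

Lemma sum_qweight_le G H c u : circ_wf c ->
  \sum_x qweight G H c u x <= (size c)%:R * nrm2 u.
Proof.
elim: c u => [|g c IH] u /=; first by rewrite big1// mul0r.
move=> [wg wc]; rewrite big_split/= -[(size c).+1]add1n natrD mulrDl mul1r lerD//.
  by apply: sum_reg_le => // a; exact: sqn_ge0.
apply: le_trans (IH _ wc) _; rewrite nrm2_isometry//; exact: gate_isometry.
Qed.

(** The two gates agree on the part of [u] that does not query [x]. On the rest, [ub], both are
    isometries, and [nrm2B_le] gives [2 + 2 = 4] times its squared norm. *)
Lemma gate_diff_le G H G' H' g u x : instr_wf g ->
  (forall a b : 'I_(2 ^ w), reg g b != Some x ->
     gate_mat G' H' g a b = gate_mat G H g a b :> C) ->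
  nrm2 (gate_mat G' H' g *m u - gate_mat G H g *m u) <= 4 * gweight g u x.
Proof.
move=> wg gg.
pose ub : 'cV[C]_(2 ^ w) := \col_a (if reg g a == Some x then u a 0 else 0).
have -> : gate_mat G' H' g *m u - gate_mat G H g *m u =
    gate_mat G' H' g *m ub - gate_mat G H g *m ub.
  rewrite -!mulmxBl; apply/colP => a; rewrite mxE [RHS]mxE; apply: eq_bigr => b _.
  rewrite [ub b 0]mxE; have [//|/gg h] := eqVneq (reg g b) (Some x).
  have mxB (A B : 'M[C]_(2 ^ w)) : (A - B) a b = A a b - B a b by rewrite !mxE.
  by rewrite mxB h subrr !mul0r.
apply: le_trans (nrm2B_le _ _) _.
rewrite !nrm2_isometry; [|exact: gate_isometry..].
rewrite -mulrDl -natrD; apply: ler_wpM2l; first by rewrite ler0n.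
rewrite /gweight [leRHS]big_mkcond/=; apply: ler_sum => a _.
by rewrite mxE; case: ifP => // _; rewrite sqn0.
Qed.

(** Hybrid argument exchanging the gates one at a time from the front. The later gates preserve
    norms, so each exchange costs [eta] plus [4 / eta] times the query weight of that gate along the
    run with the original oracles. *)
Lemma acc_run_diff_le G H G' H' c u x (eta : R) : 0 < eta -> circ_wf c ->
  (forall g (a b : 'I_(2 ^ w)), reg g b != Some x ->
     gate_mat G' H' g a b = gate_mat G H g a b :> C) ->
  nrm2 u <= 1 ->
  `|acc (run G' H' c u) - acc (run G H c u)| <=
    (size c)%:R * eta + 4 / eta * qweight G H c u x.
Proof.
move=> e0 wc gg; elim: c wc u => [_|g c IH /= [wg wc]] u u1.
  by rewrite subrr normr0 mul0r mulr0 addr0.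
have gu1 : nrm2 (gate_mat G H g *m u) <= 1.
  by rewrite nrm2_isometry//; exact: gate_isometry.
have gu1' : nrm2 (gate_mat G' H' g *m u) <= 1.
  by rewrite nrm2_isometry//; exact: gate_isometry.
have h1 := IH wc _ gu1.
have := acc_diff_le (run G' H' c (gate_mat G' H' g *m u))
  (run G' H' c (gate_mat G H g *m u)) e0.
rewrite -runB !nrm2_run// => h2.
have h3 := gate_diff_le u wg (gg g).
(* The intermediate run uses the old oracles in the first gate and the new ones afterwards. *)
apply: le_trans (ler_distD (acc (run G' H' c (gate_mat G H g *m u))) _ _) _.
apply: le_trans (lerD h2 h1) _.
rewrite -[(size c).+1]add1n natrD.
have -> : (1%:R + (size c)%:R) * eta + 4 / eta *
    (gweight g u x + qweight G H c (gate_mat G H g *m u) x) =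
  (4 * gweight g u x / eta + eta) +
  ((size c)%:R * eta + 4 / eta * qweight G H c (gate_mat G H g *m u) x) by ring.
rewrite lerD2r lerD//; first by rewrite ler_wpM2r// invr_ge0 ltW.
rewrite -[leRHS]mulr1 -mulrA ler_wpM2l ?(ltW e0)//.
rewrite ler_pdivrMl ?ltr0n// mulr1; exact: lerD.
Qed.

End Run.

Lemma ReD (y z : C) : complex.Re (y + z) = complex.Re y + complex.Re z.
Proof. by case: y z => [a b] [c d]. Qed.

Lemma Re_sum (I : Type) (r : seq I) (P : pred I) (F : I -> C) :
  complex.Re (\sum_(i <- r | P i) F i) = \sum_(i <- r | P i) complex.Re (F i).
Proof. by apply: big_morph => //; exact: ReD. Qed.

Lemma sqn_conjc (z : C) : sqn (conjc z) = sqn z.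
Proof. by case: z => a b; rewrite /sqn /= sqrrN. Qed.

(** Expand the squared modulus of [p * y - q * conjc z], which is nonnegative. *)
Lemma Re_mul_le (p q : R) (y z : C) :
  2 * (p * q) * complex.Re (y * z) <= p ^+ 2 * sqn y + q ^+ 2 * sqn z.
Proof.
case: y z => [a b] [c d]; rewrite /sqn /=.
have := sqr_ge0 (p * a - q * c); have := sqr_ge0 (p * b + q * d); nra.
Qed.

(* Entry of the one-qubit operator [1/2 \sum_th H^th |v><v| H^th]. *)
Definition half_amp (v x x' : bool) : C :=
  2^-1 * \sum_(th : bool) conj_amp th v x * conj_amp th v x'.

(** The squared Frobenius norm of the average of two projectors with overlap [1/2]:
    [(1 + 1 + 2 * 1/2) / 4]. *)
Lemma sum_half_amp v : \sum_(p : bool * bool) sqn (half_amp v p.1 p.2) = 3 / 4.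
Proof.
have h : isq2 * isq2 = 2^-1 :> C.
  have e := @isq2_sqr R; rewrite -mulr2n -mulr_natl in e.
  by rewrite -[LHS](mulKf (_ : 2%:R != 0)) ?pnatr_eq0// e mulr1.
have h2 : 2^-1 = (2^-1)%:C%C :> C by rewrite fmorphV/= rmorph_nat.
rewrite -(pair_bigA _ (fun x x' => sqn (half_amp v x x')))/= !big_bool /half_amp !big_bool /conj_amp.
case: v; rewrite /= ?mulrNN ?mulNr ?mulrN ?h ?mulr0 ?mul0r ?addr0 ?add0r ?mulr1 h2 /sqn/=; by field.
Qed.

(** Expand the squared modulus into a double sum; the average over independent basis bits then
    factors over the qubits. *)
Lemma sqn_sum_amp n (v : bits n) (z : bits n -> C) :
  avg (fun th : bits n => sqn (\sum_(x : bits n) amp th v x * z x)) =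
  \sum_(p : bits n * bits n)
    complex.Re ((\prod_i half_amp (v i) (p.1 i) (p.2 i)) * (z p.1 * conjc (z p.2))).
Proof.
have avgRe (F : bits n -> C) : avg (fun th => complex.Re (F th)) =
    complex.Re (((2 ^ n)%:R^-1)%:C%C * \sum_th F th).
  rewrite /avg -Re_sum card_bits; case: (\sum_th F th) => a b /=.
  by rewrite mul0r subr0.
transitivity (\sum_(p : bits n * bits n) avg (fun th : bits n =>
    complex.Re (amp th v p.1 * amp th v p.2 * (z p.1 * conjc (z p.2))))).
  rewrite -avg_sum; apply: eq_avg => th.
  have -> (y : C) : sqn y = complex.Re (y * conjc y) by rewrite mul_conjc.
  rewrite -Re_sum; congr (complex.Re _).
  rewrite rmorph_sum/= mulr_suml -(pair_bigA _ (fun x x' : bits n =>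
    amp th v x * amp th v x' * (z x * conjc (z x'))))/=.
  apply: eq_bigr => x _; rewrite mulr_sumr; apply: eq_bigr => x' _.
  by rewrite rmorphM/= amp_real mulrACA.
apply: eq_bigr => -[x x'] _ /=; rewrite avgRe -mulr_suml mulrA; congr (complex.Re (_ * _)).
rewrite /half_amp big_split/= prodr_const card_ord.
rewrite bigA_distr_bigA/=; congr (_ * _).
  by rewrite fmorphV/= rmorph_nat natrX exprVn.
by apply: eq_bigr => th _; rewrite -big_split.
Qed.

(** A quadratic form is at most the Frobenius norm of its matrix times the squared norm of the
    vector. Instead of Cauchy-Schwarz, [Re_mul_le] is applied entrywise with weights [Z] and [g],
    which balance the two sides and avoid the root of [3 / 4]. *)
Lemma sqn_sum_amp_le n (v : bits n) (z : bits n -> C) :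
  avg (fun th : bits n => sqn (\sum_(x : bits n) amp th v x * z x)) <=
  (7 / 8) ^+ n * \sum_x sqn (z x).
Proof.
set A := avg _; set g := (7 / 8) ^+ n; set Z := \sum_x _.
have g0 : 0 < g by rewrite exprn_gt0// divr_gt0 ?ltr0n.
have Z0 : 0 <= Z by apply: sumr_ge0 => x _; exact: sqn_ge0.
(* The balancing ends with a division by [Z * g]; when [Z] vanishes, so does every [z x]. *)
have [Z00|Zp] := eqVneq Z 0; last first.
  have {}Zp : 0 < Z by rewrite lt_neqAle eq_sym Zp.
  have : 2 * (Z * g) * A <= Z ^+ 2 * g ^+ 2 + g ^+ 2 * Z ^+ 2.
    rewrite /A sqn_sum_amp mulr_sumr.
    apply: (@le_trans _ _ (\sum_(p : bits n * bits n)
      (Z ^+ 2 * sqn (\prod_i half_amp (v i) (p.1 i) (p.2 i)) +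
       g ^+ 2 * sqn (z p.1 * conjc (z p.2))))).
      by apply: ler_sum => p _; exact: Re_mul_le.
    rewrite big_split/= -!mulr_sumr lerD//; last first.
      apply: ler_wpM2l; first exact: sqr_ge0.
      rewrite -(pair_bigA _ (fun x x' => sqn (z x * conjc (z x'))))/= expr2 mulr_suml.
      apply: ler_sum => x _; rewrite mulr_sumr; apply: ler_sum => x' _.
      by rewrite sqnM sqn_conjc.
    apply: ler_wpM2l; first exact: sqr_ge0.
    rewrite -(pair_bigA _ (fun x x' : bits n => sqn (\prod_i half_amp (v i) (x i) (x' i))))/=.
    have -> : \sum_(x : bits n) \sum_(x' : bits n) sqn (\prod_i half_amp (v i) (x i) (x' i)) =
        \prod_(i < n) \sum_(a : bool) \sum_(a' : bool) sqn (half_amp (v i) a a').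
      rewrite bigA_distr_bigA/=; apply: eq_bigr => x _.
      rewrite bigA_distr_bigA/=; apply: eq_bigr => x' _.
      by rewrite sqn_prod.
    rewrite /g -exprM mulnC exprM.
    (* [7 / 8] is chosen because its square [49 / 64] exceeds [48 / 64 = 3 / 4]. *)
    have -> : (7 / 8 : R) ^+ 2 = 49 / 64 by field.
    rewrite -[n in leRHS]card_ord -prodr_const.
    apply: ler_prod => i _.
    rewrite (pair_bigA _ (fun a a' => sqn (half_amp (v i) a a')))/= sum_half_amp.
    by apply/andP; split; lra.
  have -> : Z ^+ 2 * g ^+ 2 + g ^+ 2 * Z ^+ 2 = 2 * (Z * g) * (g * Z) by ring.
  by rewrite ler_pM2l// !mulr_gt0.
rewrite Z00 mulr0.
have z0 x : z x = 0.
  have /eqP := Z00; rewrite psumr_eq0; last by move=> y _; exact: sqn_ge0.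
  move=> /allP/(_ x (mem_index_enum _)) /=.
  rewrite /sqn paddr_eq0 ?sqr_ge0// !sqrf_eq0; case: (z x) => a b /= /andP[/eqP-> /eqP->] //.
apply: avg_le => // th; rewrite big1 ?sqn0// => x _.
by rewrite z0 mulr0.
Qed.

(** Querying [v] amounts to guessing [v] from its encoding in a random unknown basis. Per basis
    state, [sqn_sum_amp_le] bounds the one guess made there. The vectors [e x] are arbitrary, so the
    induction can push each gate onto them by linearity. *)
Lemma avg_qweight_le w l m (reg : instr w l m -> nat -> option (bits m))
    (G : bits l -> bits m) (H : bits m -> bits l) (c : seq (instr w l m))
    (e : bits m -> 'cV[C]_(2 ^ w)) : circ_wf c ->
  \sum_(v : bits m) avg (fun th : bits m =>
      qweight reg G H c (\sum_(x : bits m) amp th v x *: e x) v) <=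
  (size c)%:R * ((7 / 8) ^+ m * \sum_x nrm2 (e x)).
Proof.
set g := (7 / 8) ^+ m.
elim: c e => [|g0 c IH] e /=.
  by move=> _; rewrite mul0r big1// => v _; apply: avg_cst; exact: bits_gt0.
move=> [wg wc].
rewrite (eq_bigr (fun v : bits m =>
  avg (fun th : bits m => gweight reg g0 (\sum_(x : bits m) amp th v x *: e x) v) +
  avg (fun th : bits m => qweight reg G H c (gate_mat G H g0 *m \sum_(x : bits m) amp th v x *: e x) v))); last first.
  by move=> v _; rewrite -avgD.
rewrite big_split/= -[(size c).+1]add1n natrD mulrDl mul1r lerD//; last first.
  have := IH (fun x => gate_mat G H g0 *m e x) wc.
  have -> : \sum_x nrm2 (gate_mat G H g0 *m e x) = \sum_x nrm2 (e x).
    by apply: eq_bigr => x _; rewrite nrm2_isometry//; exact: gate_isometry.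
  apply: le_trans; apply: ler_sum => v _; apply: ler_avg => th.
  have <-// : gate_mat G H g0 *m (\sum_(x : bits m) amp th v x *: e x) =
    \sum_(x : bits m) amp th v x *: (gate_mat G H g0 *m e x).
  by rewrite mulmx_sumr; apply: eq_bigr => x _; rewrite scalemxAr.
rewrite /nrm2 exchange_big mulr_sumr/=.
apply: (@le_trans _ _ (\sum_v \sum_(a < 2 ^ w | reg g0 a == Some v)
  avg (fun th : bits m => sqn ((\sum_(x : bits m) amp th v x *: e x) a 0)))); last first.
  apply: sum_reg_le.
  - by move=> a; rewrite mulr_ge0 ?exprn_ge0 ?divr_ge0 ?ler0n// sumr_ge0// => x _; exact: sqn_ge0.
  - move=> v a; apply: le_trans _ (sqn_sum_amp_le v (fun x => e x a 0)).
    by apply: ler_avg => th; rewrite summxE; under eq_bigr do rewrite mxE.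
apply: ler_sum => v _; rewrite /gweight le_eqVlt; apply/orP; left; apply/eqP.
by rewrite /avg exchange_big mulr_sumr.
Qed.

End Hybrid.

(** * Conjugate coding states and the two reprogramming steps *)

Section Indices.

Lemma sum_divmod (V : nmodType) n1 n2 (F : nat -> nat -> V) : (0 < n1)%N ->
  \sum_(a < n1 * n2) F (a %% n1)%N (a %/ n1)%N = \sum_(z < n2) \sum_(x < n1) F x z.
Proof.
move=> n0; elim: n2 => [|n IH]; first by rewrite muln0 !big_ord0.
rewrite big_ord_recr/= -IH mulnS addnC big_split_ord/=; congr (_ + _).
apply: eq_bigr => x _.
by rewrite mulnC modnMDl modn_small// divnMDl// divn_small// addn0.
Qed.

Lemma bitn_mod m a (i : 'I_m) : bitn (a %% 2 ^ m) i = bitn a i.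
Proof.
rewrite /bitn [in RHS](divn_eq a (2 ^ m)).
rewrite -[in (_ * 2 ^ m)%N](subnK (ltnW (ltn_ord i))) expnD mulnA divnMDl ?expn_gt0//.
rewrite oddD oddM oddX.
have : (0 < m - i)%N by rewrite subn_gt0.
by case: (m - i)%N => // k _; rewrite /= andbF.
Qed.

Lemma bitn_div m a j : bitn (a %/ 2 ^ m) j = bitn a (m + j).
Proof. by rewrite /bitn expnD divnMA. Qed.

End Indices.

Section Kets.
Context {R : realType}.
Local Notation C := R[i].
Variables (l m : nat).
Implicit Types (th v : bits m) (h : bits l).

Lemma cp_ketE th v h a : (a < 2 ^ (m + l))%N ->
  cp_ket th v h a = amp th v (fun i : 'I_m => bitn (a %% 2 ^ m) i) *
    [forall j : 'I_l, bitn (a %/ 2 ^ m) j == h j]%:R :> C.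
Proof.
move=> am; rewrite /cp_ket am andbT; congr (_ * _%:R).
  by apply: eq_bigr => i _; rewrite bitn_mod.
by congr nat_of_bool; apply: eq_forallb => j; rewrite bitn_div.
Qed.

Lemma sum_bits_eq (V : pzSemiRingType) n (h : bits n) (F : bits n -> V) :
  \sum_(x : bits n) F x * [forall j, x j == h j]%:R = F h.
Proof.
rewrite (bigD1 h)//= big1 ?addr0.
  have -> : [forall j, h j == h j] by apply/forallP.
  by rewrite mulr1.
move=> x xh; have /negbTE -> : ~~ [forall j, x j == h j]; last by rewrite mulr0.
by apply: contraNN xh => /forallP e; apply/eqP/ffunP => j; apply/eqP.
Qed.

Lemma cp_ket_nrm th v h : \sum_(a < 2 ^ (m + l)) sqn (cp_ket th v h a : C) = 1.
Proof.
under eq_bigr => a _ do rewrite cp_ketE// sqnM.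
have sqn_nat (b : bool) : sqn (b%:R : C) = b%:R.
  by case: b; rewrite ?sqn0// /sqn/= expr1n expr0n addr0.
rewrite expnD (sum_divmod _ (fun x z => sqn (amp th v (fun i : 'I_m => bitn x i)) *
  sqn ([forall j : 'I_l, bitn z j == h j]%:R : C))) ?expn_gt0//.
under eq_bigr do rewrite -mulr_suml.
rewrite -mulr_sumr (sum_bits _ (fun x => sqn (amp th v (fun i : 'I_m => bitn x i)))).
rewrite (sum_bits _ (fun z => sqn ([forall j : 'I_l, bitn z j == h j]%:R : C))).
rewrite [X in _ * X](eq_bigr (fun x : bits l => 1 * [forall j, x j == h j]%:R)).
  rewrite (sum_bits_eq h (fun _ => 1)) mulr1.
  apply: (@complexI R); rewrite rmorph_sum/= rmorph1.
  rewrite (eq_bigr (fun x : bits m => amp th v x * amp th v x)).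
    by rewrite amp_orth; have -> : [forall i, v i == v i] by apply/forallP.
  move=> x _; rewrite -mul_conjc amp_real.
  by congr (_ * _); apply: eq_bigr => i _; rewrite bitn_of_bits.
move=> x _; rewrite sqn_nat mul1r; congr (_%:R); congr nat_of_bool.
by apply: eq_forallb => j; rewrite bitn_of_bits.
Qed.

Lemma amp0E n (v x : 'I_n -> bool) :
  amp (fun _ => false) v x = [forall i, v i == x i]%:R :> C.
Proof.
rewrite /amp /conj_amp; have [/forallP h|/forallPn[i vi]] := boolP [forall i, v i == x i].
  by rewrite big1// => i _; rewrite h.
by rewrite (bigD1 i)//= (negbTE vi) mul0r.
Qed.

Definition zero_bits : bits m := [ffun=> false].

(** [cp_ket zero_bits x h] is the computational basis state of [x] and [h]; the expansion has the
    shape that [avg_qweight_le] asks for. *)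
Lemma cp_ket_decomp th v h a :
  cp_ket th v h a = \sum_(x : bits m) amp th v x * cp_ket zero_bits x h a :> C.
Proof.
rewrite /cp_ket; under [RHS]eq_bigr do rewrite mulrA.
rewrite -mulr_suml; congr (_ * _).
pose y : bits m := [ffun i : 'I_m => bitn a i].
transitivity (amp th v y : C); first by apply: eq_bigr => i _; rewrite ffunE.
rewrite -(sum_bits_eq y (fun x : bits m => amp th v x : C)); apply: eq_bigr => x _.
congr (_ * _); transitivity (amp (fun _ => false) x y : C); first by rewrite amp0E.
by apply: eq_bigr => i _; rewrite !ffunE.
Qed.

(** Completeness of the orthonormal basis of kets for a fixed [th]. By the symmetry [ampC] the sum
    over [v] is again an instance of [amp_orth]. *)
Lemma cp_ket_complete th a b : (a < 2 ^ (m + l))%N -> (b < 2 ^ (m + l))%N ->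
  \sum_(v : bits m) \sum_(h : bits l) cp_ket th v h a * conjc (cp_ket th v h b) =
  (a == b)%:R :> C.
Proof.
move=> al bl.
pose am : bits m := [ffun i : 'I_m => bitn (a %% 2 ^ m) i].
pose ah : bits l := [ffun i : 'I_l => bitn (a %/ 2 ^ m) i].
pose bm : bits m := [ffun i : 'I_m => bitn (b %% 2 ^ m) i].
pose bh : bits l := [ffun i : 'I_l => bitn (b %/ 2 ^ m) i].
have E x (xm : bits m) (xh : bits l) v h : (x < 2 ^ (m + l))%N ->
    (forall i : 'I_m, xm i = bitn (x %% 2 ^ m) i) -> (forall i : 'I_l, xh i = bitn (x %/ 2 ^ m) i) ->
    cp_ket th v h x = amp th xm v * [forall j, h j == xh j]%:R :> C.
  move=> xl xmE xhE; rewrite cp_ketE// ampC; congr (_ * _%:R).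
    by apply: eq_bigr => i _; rewrite xmE.
  by congr nat_of_bool; apply: eq_forallb => i; rewrite xhE eq_sym.
rewrite (eq_bigr (fun v : bits m => (amp th am v * amp th bm v) * [forall j, ah j == bh j]%:R)).
  rewrite -mulr_suml amp_orth -natrM mulnb; congr (_%:R); congr nat_of_bool.
  apply/andP/eqP => [[/forallP h1 /forallP h2]|e].
    apply: (bitn_inj al bl) => k; case: (split_ordP k) => i ->.
      by have := h1 i; rewrite !ffunE !bitn_mod => /eqP.
    by have := h2 i; rewrite !ffunE !bitn_div => /eqP.
  by split; apply/forallP => i; rewrite !ffunE e.
move=> v _.
rewrite -(sum_bits_eq ah (fun h : bits l => amp th am v * amp th bm v * [forall j, h j == bh j]%:R)).
apply: eq_bigr => h _.
rewrite (E a am ah)//; try by move=> i; rewrite ffunE.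
rewrite (E b bm bh)//; try by move=> i; rewrite ffunE.
by rewrite rmorphM/= amp_real rmorph_nat mulrACA -[RHS]mulrA; congr (_ * _); exact: mulrC.
Qed.

Variables (q w : nat).
Hypothesis hw : (m + l + q <= w)%N.

(** The pure-state counterpart of [input_state], with zeros on the work qubits. *)
Definition inp (X phi : nat -> C) : 'cV[C]_(2 ^ w) :=
  \col_a (if (a %/ 2 ^ (m + l + q) == 0)%N
     then X (a %% 2 ^ (m + l))%N * phi ((a %/ 2 ^ (m + l)) %% 2 ^ q)%N else 0).

Lemma nrm2_inp X phi : nrm2 (inp X phi) =
  (\sum_(a < 2 ^ (m + l)) sqn (X a)) * (\sum_(z < 2 ^ q) sqn (phi z)).
Proof.
pose F x z := sqn (X x) * sqn (phi (z %% 2 ^ q)%N).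
transitivity (\sum_(a < 2 ^ (m + l + q)) F (a %% 2 ^ (m + l))%N (a %/ 2 ^ (m + l))%N).
  rewrite (big_ord_widen (2 ^ w) (fun a => F (a %% 2 ^ (m + l))%N (a %/ 2 ^ (m + l))%N)) ?leq_exp2l//.
  rewrite big_mkcond; apply: eq_bigr => a _.
  rewrite mxE eqn0Ngt divn_gt0 ?expn_gt0// -ltnNge.
  by case: ifP => _; rewrite ?sqn0// sqnM.
rewrite expnD sum_divmod ?expn_gt0// mulr_sumr; apply: eq_bigr => z _.
by rewrite mulr_suml; apply: eq_bigr => x _; rewrite /F modn_small.
Qed.

Lemma inp_cp_ket th v h phi :
  inp (cp_ket th v h) phi = \sum_(x : bits m) amp th v x *: inp (cp_ket zero_bits x h) phi.
Proof.
apply/colP => a; rewrite summxE mxE.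
under eq_bigr do rewrite !mxE.
case: ifP => _; last by rewrite big1// => x _; rewrite mulr0.
by rewrite cp_ket_decomp mulr_suml; apply: eq_bigr => x _; rewrite mulrA.
Qed.

Variable c : seq (instr w l m).
Hypothesis wc : circ_wf c.

Definition regG (g : instr w l m) (a : nat) : option (bits l) :=
  if g is IqG xin _ then Some [ffun i => bitn a (xin i)] else None.

Definition regH (g : instr w l m) (a : nat) : option (bits m) :=
  if g is IqH vin _ then Some [ffun i => bitn a (vin i)] else None.

Lemma gate_updG (G : {ffun bits l -> bits m}) (H : bits m -> bits l) y t g
    (a b : 'I_(2 ^ w)) : regG g b != Some y ->
  gate_mat (upd G y t) H g a b = gate_mat G H g a b :> C.
Proof.
case: g => // xin zout /= gb; rewrite !mxE; congr (_ == _)%:R.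
apply: eq_bigr => k _; congr ((_ (+) _) * _)%N.
apply: eq_existsb => j; congr (_ && _); rewrite ffunE.
by case: eqP => // e; rewrite e eqxx in gb.
Qed.

Lemma gate_updH (G : bits l -> bits m) (H : {ffun bits m -> bits l}) y t g
    (a b : 'I_(2 ^ w)) : regH g b != Some y ->
  gate_mat G (upd H y t) g a b = gate_mat G H g a b :> C.
Proof.
case: g => // xin zout /= gb; rewrite !mxE; congr (_ == _)%:R.
apply: eq_bigr => k _; congr ((_ (+) _) * _)%N.
apply: eq_existsb => j; congr (_ && _); rewrite ffunE.
by case: eqP => // e; rewrite e eqxx in gb.
Qed.

Variable phi : nat -> C.
Hypothesis phi1 : \sum_(z < 2 ^ q) sqn (phi z) = 1.

Definition ket th v h := inp (cp_ket th v h) phi.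

Lemma nrm2_ket th v h : nrm2 (ket th v h) = 1.
Proof. by rewrite nrm2_inp cp_ket_nrm phi1 mulr1. Qed.

(** The ket has [th] and [h] as free parameters, decoupled from the oracles; the real experiment
    sets [th = G y] and [h = H v]. *)
Definition accket (G : bits l -> bits m) (H : bits m -> bits l) th v h : R :=
  acc (run G H c (ket th v h)).

Lemma accket01 G H th v h : 0 <= accket G H th v h <= 1.
Proof.
rewrite acc_ge0/= (le_trans (acc_le_nrm2 _))//.
by rewrite nrm2_run// nrm2_ket.
Qed.

Local Notation T := ((size c)%:R : R).

Lemma avg_itv01 (S : finType) (f : S -> R) :
  (forall s, 0 <= f s <= 1) -> 0 <= avg f <= 1.
Proof.
move=> f01; apply/andP; split; first by apply: avg_ge0 => s; case/andP: (f01 s).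
by apply: avg_le => // s; case/andP: (f01 s).
Qed.

Lemma ler_sum_avg_affine (X S : finType) (mu : X -> R) (Q : S -> X -> R) (a b K : R) :
  (0 < #|S|)%N -> \sum_x mu x = 1 -> 0 <= b ->
  \sum_x mu x * avg (Q^~ x) <= K ->
  \sum_x mu x * avg (fun s => a + b * Q s x) <= a + b * K.
Proof.
move=> S0 mu1 b0 h.
under eq_bigr do rewrite avgD avg_cst// avgZ mulrDr mulrCA.
by rewrite big_split/= -mulr_suml mu1 mul1r lerD2l -mulr_sumr ler_wpM2l.
Qed.

(** Once [th] replaces [G y], the ket carries no information on [y], so the [D]-average of the query
    weight at [y] is at most [kap] times the total weight. One bound [ed] therefore meets both
    smallness conditions of [oracle_concentration]. *)
Lemma reprogram_G (D : {ffun bits l -> R}) (H : {ffun bits m -> bits l}) (kap eta eta' : R) :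
  0 < eta -> 0 < eta' ->
  (forall y, 0 <= D y) -> \sum_y D y = 1 -> (forall y, D y <= kap) ->
  avg (fun G : {ffun bits l -> bits m} =>
    `|\sum_y D y * (avg (fun v => accket G H (G y) v (H v)) -
        avg (fun th => avg (fun v => accket G H th v (H v))))|) <=
  eta' + (kap + 4 * (T * eta + 4 / eta * (kap * T))) / eta'.
Proof.
move=> e0 e0' D0 D1 Dk.
pose e (G : {ffun bits l -> bits m}) (y y' : bits l) (th : bits m) :=
  avg (fun v => T * eta + 4 / eta * qweight regG G H c (ket th v (H v)) y).
have ed (G : {ffun bits l -> bits m}) (y' : bits l) th :
    \sum_y D y * e G y y' th <= T * eta + 4 / eta * (kap * T).
  apply: ler_sum_avg_affine => //; first exact: bits_gt0.
    by rewrite divr_ge0// (ltW e0).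
  under eq_bigr do rewrite -avgZ.
  rewrite -avg_sum; apply: avg_le => [|v].
    have /card_gt0P[y _] := bits_gt0 l.
    by rewrite mulr_ge0// (le_trans (D0 y)).
  apply: (@le_trans _ _ (\sum_y kap * qweight regG G H c (ket th v (H v)) y)).
    by apply: ler_sum => y _; apply: ler_wpM2r => //; exact: qweight_ge0.
  rewrite -mulr_sumr; apply: ler_wpM2l.
    have /card_gt0P[y _] := bits_gt0 l.
    by rewrite (le_trans (D0 y)).
  by apply: le_trans (sum_qweight_le _ _ _ _ wc) _; rewrite nrm2_ket mulr1.
apply: (@oracle_concentration _ _ _ D kap (bits_gt0 m) D0 D1 Dk
  (T * eta + 4 / eta * (kap * T))
  (fun G _ th => avg (fun v => accket G H th v (H v))) e) => //.
- by move=> G y th; apply: avg_itv01 => v; exact: accket01.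
- move=> G y t y' th; rewrite -avgB; apply: le_trans (ler_norm_avg _) _.
  apply: ler_avg => v; apply: acc_run_diff_le => //.
    by move=> g a b; exact: gate_updG.
  by rewrite nrm2_ket.
- by move=> G th; exact: (ed G [ffun=> false]).
Qed.

(** Here the ket does encode the reprogrammed point [v]. Averaging over [th] inside the function fed
    to [oracle_concentration] is what makes a query at [v] unlikely. *)
Lemma reprogram_H (G : {ffun bits l -> bits m}) (eta eta' : R) :
  0 < eta -> 0 < eta' ->
  avg (fun H : {ffun bits m -> bits l} =>
    `|avg (fun th => avg (fun v => accket G H th v (H v))) -
      avg (fun th => avg (fun v => avg (fun h => accket G H th v h)))|) <=
  eta' + ((7 / 8) ^+ m + 4 * (T * eta + 4 / eta * ((7 / 8) ^+ m * T))) / eta'.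
Proof.
move=> e0 e0'; set k := (7 / 8) ^+ m.
pose mu (v : bits m) : R := #|{: bits m}|%:R^-1.
have mu0 v : 0 <= mu v by rewrite invr_ge0 ler0n.
have avg_mu (f : bits m -> R) : avg f = \sum_v mu v * f v by rewrite /avg mulr_sumr.
have mu1 : \sum_v mu v = 1.
  rewrite -[RHS](avg_cst 1 (bits_gt0 m)) avg_mu.
  by under [RHS]eq_bigr do rewrite mulr1.
have T0 : 0 <= T by rewrite ler0n.
have k0 : 0 <= k by rewrite exprn_ge0// divr_ge0 ?ler0n.
(* [2 ^- m <= (7 / 8) ^+ m], so the same [k] bounds the uniform weights and the guessing
   probability. *)
have muk v : mu v <= k.
  rewrite /mu card_bits natrX -exprVn; apply: lerXn2r; rewrite ?nnegrE; lra.
pose e (H : {ffun bits m -> bits l}) (v v' : bits m) (h : bits l) :=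
  avg (fun th => T * eta + 4 / eta * qweight regH G H c (ket th v' h) v).
have b0 : 0 <= 4 / eta by rewrite divr_ge0// (ltW e0).
have exch (H : {ffun bits m -> bits l}) :
    avg (fun th => avg (fun v => accket G H th v (H v))) -
      avg (fun th => avg (fun v => avg (fun h => accket G H th v h))) =
    \sum_v mu v * (avg (fun th => accket G H th v (H v)) -
      avg (fun h => avg (fun th => accket G H th v h))).
  rewrite exchange_avg (exchange_avg (fun th v => avg (fun h => accket G H th v h))).
  by rewrite -avgB avg_mu; apply: eq_bigr => v _; rewrite (exchange_avg (fun th h => accket G H th v h)).
under eq_avg do rewrite exch.
(* Ket and queried point coincide: the guessing bound applies, and its [2 ^ m] unit vectors cancel
   the uniform weight. *)
have ed (H : {ffun bits m -> bits l}) (h : bits l) :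
    \sum_v mu v * e H v v h <= T * eta + 4 / eta * (k * T).
  apply: ler_sum_avg_affine => //; first exact: bits_gt0.
  rewrite /mu -mulr_sumr; under eq_bigr do under eq_avg do rewrite /ket inp_cp_ket.
  apply: le_trans (ler_wpM2l _ (avg_qweight_le _ _ _ _ wc)) _; first by rewrite invr_ge0 ler0n.
  under eq_bigr do rewrite -/(ket _ _ _) nrm2_ket.
  rewrite sumr_const -/k.
  have N0 : #|{: bits m}|%:R != 0 :> R by rewrite pnatr_eq0 -lt0n bits_gt0.
  by rewrite le_eqVlt; apply/orP; left; apply/eqP; field.
(* The ket encodes a fixed [v'] while [v] varies, so counting queries suffices. *)
have ed' (H : {ffun bits m -> bits l}) (v' : bits m) (h : bits l) :
    \sum_v mu v * e H v v' h <= T * eta + 4 / eta * (k * T).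
  apply: ler_sum_avg_affine => //; first exact: bits_gt0.
  under eq_bigr do rewrite -avgZ.
  rewrite -avg_sum; apply: avg_le => [|th]; first by rewrite mulr_ge0.
  apply: (@le_trans _ _ (\sum_v k * qweight regH G H c (ket th v' h) v)).
    by apply: ler_sum => y _; apply: ler_wpM2r => //; exact: qweight_ge0.
  rewrite -mulr_sumr; apply: ler_wpM2l => //.
  by apply: le_trans (sum_qweight_le _ _ _ _ wc) _; rewrite nrm2_ket mulr1.
apply: (@oracle_concentration _ _ _ mu k (bits_gt0 l) mu0 mu1 muk
  (T * eta + 4 / eta * (k * T))
  (fun H v h => avg (fun th => accket G H th v h)) e) => //.
- by move=> H v h; apply: avg_itv01 => th; exact: accket01.
- move=> H v h v' h'; rewrite -avgB; apply: le_trans (ler_norm_avg _) _.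
  apply: ler_avg => th; apply: acc_run_diff_le => //.
    by move=> g a b; exact: gate_updH.
  by rewrite nrm2_ket.
Qed.

Lemma distinguishing_bound (D : {ffun bits l -> R}) (kap eta eta' : R) :
  0 < eta -> 0 < eta' ->
  (forall y, 0 <= D y) -> \sum_y D y = 1 -> (forall y, D y <= kap) ->
  (7 / 8) ^+ m <= kap ->
  avg (fun G : {ffun bits l -> bits m} => avg (fun H : {ffun bits m -> bits l} =>
    `|\sum_y D y * avg (fun v => accket G H (G y) v (H v)) -
      avg (fun th => avg (fun v => avg (fun h => accket G H th v h)))|)) <=
  2 * (eta' + (kap + 4 * (T * eta + 4 / eta * (kap * T))) / eta').
Proof.
move=> e0 e0' D0 D1 Dk mk.
set B := eta' + _.
(* Intermediate experiment: the basis is already uniform, while the tag is still [H v]. *)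
pose mid (G : {ffun bits l -> bits m}) (H : {ffun bits m -> bits l}) :=
  avg (fun th => avg (fun v => accket G H th v (H v))).
pose dG (G : {ffun bits l -> bits m}) (H : {ffun bits m -> bits l}) :=
  `|\sum_y D y * (avg (fun v => accket G H (G y) v (H v)) - mid G H)|.
pose dH (G : {ffun bits l -> bits m}) (H : {ffun bits m -> bits l}) :=
  `|mid G H - avg (fun th => avg (fun v => avg (fun h => accket G H th v h)))|.
have kap0 : 0 <= kap.
  by apply: le_trans mk; rewrite exprn_ge0// divr_ge0 ?ler0n.
have B0 : 0 <= B.
  rewrite addr_ge0 ?(ltW e0')// divr_ge0 ?(ltW e0')// addr_ge0// mulr_ge0// addr_ge0 ?mulr_ge0//.
  - exact: ltW.
  - by rewrite invr_ge0 ltW.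
apply: (@le_trans _ _ (avg (fun G => avg (fun H => dG G H + dH G H)))).
  apply: ler_avg => G; apply: ler_avg => H.
  rewrite /dG; under [X in _ <= `|X| + _]eq_bigr do rewrite mulrBr.
  rewrite sumrB -mulr_suml D1 mul1r; apply: ler_distD.
under eq_avg do rewrite avgD.
rewrite avgD mulr2n mulrDl mul1r lerD//.
  rewrite exchange_avg; apply: avg_le => // H.
  exact: reprogram_G.
apply: avg_le => // G; apply: le_trans (reprogram_H G e0 e0') _.
rewrite /B lerD2l ler_pM2r ?invr_gt0// lerD// ler_pM2l// lerD2l.
rewrite ler_wpM2l ?divr_ge0 ?(ltW e0)// ler_wpM2r//.
Qed.

End Kets.

(** * Mixed auxiliary states *)

Section Mixed.
Context {R : realType}.
Local Notation C := R[i].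

Lemma adj_trmxC n p (M : 'M[C]_(n, p)) : adj M = map_mx (@Num.conj C) (M^T).
Proof. by rewrite /adj map_trmx. Qed.

(** The spectral theorem for the Hermitian, hence normal, matrix [nu]: the eigenvalues form a
    probability vector because [nu] is positive of trace one. *)
Lemma density_spectral n (nu : 'M[C]_n) : density nu ->
  exists (p : 'I_n -> R) (f : 'I_n -> 'cV[C]_n),
    [/\ forall k, 0 <= p k, \sum_k p k = 1, forall k, nrm2 (f k) = 1 &
        forall i j, nu i j = \sum_k (p k)%:C%C * (f k i 0 * conjc (f k j 0))].
Proof.
move=> [nuH [nu_ge0 nu_tr]].
have /orthomx_spectralP : nu \is normalmx.
  by apply/normalmxP; rewrite -adj_trmxC nuH.
set P := spectralmx nu; set sp := spectral_diag nu.
have PU : P \is unitarymx by exact: spectral_unitarymx.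
have PP : P *m adj P = 1%:M by rewrite adj_trmxC; exact/unitarymxP.
rewrite invmx_unitary// -adj_trmxC => nuE.
pose f k : 'cV[C]_n := col k (adj P).
have adjf k : adj (f k) = row k P.
  by apply/rowP => i; rewrite adjE !mxE conjcK.
have fK k : nrm2 (f k) = 1.
  have PPk : (P *m adj P) k k = 1 by rewrite PP mxE eqxx.
  apply: (@complexI R); rewrite -nrm2E adjf rmorph1 -PPk.
  by rewrite mxE [RHS]mxE; apply: eq_bigr => i _; rewrite !mxE.
(* Each eigenvalue is a value of the quadratic form, so positivity of [nu] makes it real and
   nonnegative. *)
have spE k : sp 0 k = (adj (f k) *m nu *m f k) 0 0.
  have : (P *m nu *m adj P) k k = sp 0 k.
    rewrite nuE !mulmxA PP mul1mx -mulmxA PP mulmx1.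
    by rewrite mxE eqxx mulr1n.
  move=> <-; rewrite adjf /f -row_mul mxE [RHS]mxE; apply: eq_bigr => i _.
  by rewrite !mxE.
have sp_ge0 k : 0 <= sp 0 k by rewrite spE.
exists (fun k => complex.Re (sp 0 k)), f.
have spR k : (complex.Re (sp 0 k))%:C%C = sp 0 k.
  by apply: RRe_real; exact: ger0_real.
split => //.
- by move=> k; rewrite -(ler0c (complex.Re (sp 0 k))) spR.
- apply: (@complexI R); rewrite rmorph_sum/= rmorph1 -nu_tr nuE.
  rewrite mxtrace_mulC mulmxA PP mul1mx mxtrace_diag.
  by apply: eq_bigr => k _; rewrite spR.
- move=> i j; rewrite {1}nuE mxE; apply: eq_bigr => k _.
  rewrite spR /f mul_mx_diag !mxE conjcK [RHS]mulrA; congr (_ * _); exact: mulrC.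
Qed.

Lemma mul_outer_diag n (U : 'M[C]_n) (u : 'cV[C]_n) a :
  complex.Re ((U *m (u *m adj u) *m adj U) a a) = sqn ((U *m u) a 0).
Proof.
rewrite mulmxA -mulmxA -adjM mxE big_ord1 adjE mul_conjc//.
Qed.

(** Acceptance is linear in both parts of the input, so decompositions of the two into weighted pure
    states reduce it to [acc] on vectors. *)
Lemma accept_prob_input w l m q (U : 'M[C]_(2 ^ w)) (X : nat -> nat -> C)
    (nu : 'M[C]_(2 ^ q)) (J K : finType) (cf : J -> R) (kt : J -> nat -> C)
    (p : K -> R) (phi : K -> nat -> C) :
  (forall a b, (a < 2 ^ (m + l))%N -> (b < 2 ^ (m + l))%N ->
     X a b = \sum_j (cf j)%:C%C * (kt j a * conjc (kt j b))) ->
  (forall a b, (a < 2 ^ q)%N -> (b < 2 ^ q)%N ->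
     mxf nu a b = \sum_k (p k)%:C%C * (phi k a * conjc (phi k b))) ->
  accept_prob U (input_state w l m X nu) =
  \sum_k p k * \sum_j cf j * acc (U *m inp l m q w (kt j) (phi k)).
Proof.
move=> XE nuE.
have -> : input_state w l m X nu = \sum_k \sum_j (p k * cf j)%:C%C *:
    (inp l m q w (kt j) (phi k) *m adj (inp l m q w (kt j) (phi k))).
  apply/matrixP => a b; rewrite mxE summxE.
  under [RHS]eq_bigr do rewrite summxE.
  under [RHS]eq_bigr do under eq_bigr do rewrite mxE mxE big_ord1 adjE !mxE.
  have [a0|] := eqVneq (a %/ 2 ^ (m + l + q))%N 0%N; last first.
    by move=> _ /=; rewrite big1// => k _; rewrite big1// => j _; rewrite mul0r mulr0.
  have [b0|] := eqVneq (b %/ 2 ^ (m + l + q))%N 0%N; last first.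
    by move=> _ /=; rewrite big1// => k _; rewrite big1// => j _;
       rewrite [X in _ * (_ * X)](_ : _ = conjc 0)// conjc0 !mulr0.
  rewrite /= XE ?ltn_mod ?expn_gt0// nuE ?ltn_mod ?expn_gt0//.
  rewrite mulrC mulr_suml; apply: eq_bigr => k _; rewrite mulr_sumr.
  by apply: eq_bigr => j _; rewrite !rmorphM/=; ring.
rewrite /accept_prob /acc.
under eq_bigr => a _.
  rewrite mulmx_sumr mulmx_suml summxE Re_sum.
  under eq_bigr => k _.
    rewrite mulmx_sumr mulmx_suml summxE Re_sum.
    under eq_bigr => j _.
      rewrite -scalemxAr -scalemxAl mxE.
      have ReZ (r : R) (z : C) : complex.Re (r%:C%C * z) = r * complex.Re z.
        by case: z => x y /=; rewrite mul0r subr0.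
      rewrite ReZ mul_outer_diag.
      over.
    over.
  over.
rewrite exchange_big/=; apply: eq_bigr => k _.
rewrite exchange_big mulr_sumr/=; apply: eq_bigr => j _.
by rewrite mulrA mulr_sumr.
Qed.

End Mixed.

(** * Asymptotics *)

Section Asymptotics.
Context {R : realType}.

Lemma negligible_expR_powR (a eps : R) : 0 < a -> 0 < eps ->
  negligible (fun n => expR (- (a * n%:R `^ eps))).
Proof.
move=> a0 e0 c.
(* The Taylor term of order [j.+1] grows at least like [n ^ c.+1]; the spare factor [n] absorbs the
   constant [B]. *)
pose j := Num.Def.archi_bound (c.+1%:R / eps).
have jc : c.+1%:R <= eps * j.+1%:R.
  rewrite mulrC -ler_pdivrMr//; apply: le_trans (_ : j%:R <= _); last by rewrite ler_nat.
  by apply/ltW/archi_boundP; rewrite divr_ge0 ?ler0n// ltW.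
pose B := (j.+1)`!%:R / a ^+ j.+1.
have aj0 : 0 < a ^+ j.+1 by rewrite exprn_gt0.
have f0 : 0 < (j.+1)`!%:R :> R by rewrite ltr0n fact_gt0.
have B0 : 0 < B by rewrite divr_gt0.
exists (maxn 1 (Num.Def.archi_bound B)) => n; rewrite geq_max => /andP[n1 nB].
have x1 : 1 <= n%:R :> R by rewrite ler1n.
have x0 : 0 < n%:R :> R by rewrite ltr0n.
rewrite expRN lef_pV2 ?posrE ?expR_gt0 ?exprn_gt0//.
set y := a * _.
have y0 : 0 <= y by rewrite mulr_ge0 ?powR_ge0// ltW.
apply: le_trans (expR_ge1Dxn j y0); apply: ler_wpDl => //.
have h : n%:R ^+ c.+1 <= (n%:R `^ eps) ^+ j.+1.
  rewrite -!powR_mulrn ?powR_ge0 ?(ltW x0)// -powRrM.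
  by apply: ler_powR.
have -> : y ^+ j.+1 / (j.+1)`!%:R = (n%:R `^ eps) ^+ j.+1 / B.
  by rewrite /y exprMn /B invf_div [RHS]mulrA; congr (_ / _); exact: mulrC.
apply: le_trans (_ : n%:R ^+ c.+1 / B <= _); last first.
  by rewrite ler_pM2r ?invr_gt0.
rewrite ler_pdivlMr// exprSr ler_wpM2l ?exprn_ge0 ?(ltW x0)//.
by apply: le_trans (_ : (Num.Def.archi_bound B)%:R <= _); [exact/ltW/archi_boundP/ltW|rewrite ler_nat].
Qed.

Lemma negligibleD (f g : nat -> R) :
  negligible f -> negligible g -> negligible (fun n => f n + g n).
Proof.
move=> nf ng c; have [Nf hf] := nf c.+1; have [Ng hg] := ng c.+1.
exists (maxn 2 (maxn Nf Ng)) => n; rewrite !geq_max => /and3P[n2 nNf nNg].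
apply: le_trans (lerD (hf n nNf) (hg n nNg)) _.
have x0 : 0 < n%:R :> R by rewrite ltr0n (leq_trans _ n2).
rewrite exprSr invfM -mulrDr ler_piMr ?invr_ge0 ?exprn_ge0 ?(ltW x0)//.
by rewrite -mulr2n -[_ *+ 2]mulr_natr ler_pdivrMl// mulr1 ler_nat.
Qed.

Lemma eq_negligible (f g : nat -> R) : f =1 g -> negligible f -> negligible g.
Proof. by move=> fg nf c; have [N h] := nf c; exists N => n; rewrite -fg; exact: h. Qed.

Lemma negligible_geometric (r : R) : 0 < r < 1 -> negligible (fun n => r ^+ n).
Proof.
move=> /andP[r0 r1].
have a0 : 0 < - ln r by rewrite oppr_gt0 ln_lt0// r0.
apply: eq_negligible (negligible_expR_powR a0 ltr01) => n /=.
by rewrite powRr1 ?ler0n// mulNr opprK expRM_natr lnK// posrE.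
Qed.

(** For a target [n ^- c], take [eta'] and then [eta] inverse polynomial so that the terms without
    [kap] are small; negligibility of [kap] beats the polynomial factors left on the others. *)
Lemma negligible_of_tradeoff (s : nat -> nat) (kap f : nat -> R) :
  poly_bounded s -> negligible kap -> (forall n, 0 <= kap n) ->
  (forall n eta eta', 0 < eta -> 0 < eta' ->
     f n <= 2 * (eta' + (kap n + 4 * ((s n)%:R * eta +
       4 / eta * (kap n * (s n)%:R))) / eta')) ->
  negligible f.
Proof.
move=> [a sa] nk k0 hf c.
(* The exponent pays for [2 ^+ 18 <= x ^+ 18], [B ^+ 2] and [u ^+ 4] in [M1]. Below, [n >= a + 3]
   yields both [n ^ a + a <= n ^ a.+1] and [2 <= x]. *)
have [N0 hN0] := nk (18 + 2 * a.+1 + 4 * c)%N.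
exists (maxn N0 (a + 3)) => n; rewrite geq_max => /andP[/hN0 hk na].
have n0 : (0 < n)%N by rewrite (leq_trans _ na)// addnS.
set x : R := n%:R; rewrite -/x in hk.
have x0 : 0 < x by rewrite ltr0n.
have x1 : 1 <= x by rewrite ler1n.
have x2 : 2 <= x by rewrite ler_nat (leq_trans _ na)// !addnS.
set T : R := (s n)%:R; set k := kap n in hk *; set u := x ^+ c; set B := x ^+ a.+1.
have T0 : 0 <= T by rewrite ler0n.
have u1 : 1 <= u by exact: exprn_ege1.
have B1 : 1 <= B by exact: exprn_ege1.
have u0 : 0 < u by exact: lt_le_trans u1.
have B0 : 0 < B by exact: lt_le_trans B1.
have TB : T <= B.
  rewrite /T /B /x -natrX ler_nat (leq_trans (sa n))// expnS.
  have p1 : (0 < n ^ a)%N by rewrite expn_gt0 n0.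
  apply: (@leq_trans ((a + 3) * n ^ a)%N); last by rewrite leq_mul2r na orbT.
  rewrite mulnDl addnC leq_add//; first by rewrite leq_pmulr.
  by rewrite leq_pmull.
have kk0 : 0 <= k by exact: k0.
have M1 : 2 ^+ 18 * (k * (B ^+ 2 * u ^+ 4)) <= 1.
  apply: (@le_trans _ _ (x ^+ 18 * (k * (B ^+ 2 * u ^+ 4)))).
    apply: ler_wpM2r; first by rewrite !mulr_ge0 ?exprn_ge0 ?(ltW u0) ?(ltW B0).
    by apply: lerXn2r; rewrite ?nnegrE ?ler0n// ltW.
  have -> : x ^+ 18 * (k * (B ^+ 2 * u ^+ 4)) = k * x ^+ (18 + 2 * a.+1 + 4 * c).
    have -> : x ^+ (18 + 2 * a.+1 + 4 * c) = x ^+ 18 * B ^+ 2 * u ^+ 4.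
      by rewrite /B /u -!(exprM x) -!exprD [(a.+1 * 2)%N]mulnC [(c * 4)%N]mulnC.
    by rewrite mulrCA !mulrA.
  by rewrite -ler_pdivlMr ?exprn_gt0// mul1r.
(* With these values the bound is [u^-1] times four terms, each at most [1 / 4]. *)
apply: le_trans (hf n (256 * u ^+ 2 * B)^-1 (8 * u)^-1 _ _) _.
- by rewrite invr_gt0 !mulr_gt0 ?exprn_gt0.
- by rewrite invr_gt0 mulr_gt0.
rewrite -/T -/k -/u.
have -> : 2 * ((8 * u)^-1 + (k + 4 * (T / (256 * u ^+ 2 * B) +
     4 / (256 * u ^+ 2 * B)^-1 * (k * T))) / (8 * u)^-1) =
   u^-1 * (1 / 4 + 16 * (k * u ^+ 2) + T / B / 4 + 2 ^+ 16 * (k * (T * B * u ^+ 4))).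
  by field; rewrite !gt_eqF.
rewrite ler_piMr ?invr_ge0 ?(ltW u0)//.
have h1 : T / B <= 1 by rewrite ler_pdivrMr// mul1r.
have h2 : k * (T * B * u ^+ 4) <= k * (B ^+ 2 * u ^+ 4).
  by rewrite ler_wpM2l// ler_wpM2r ?exprn_ge0 ?(ltW u0)// expr2 ler_wpM2r ?(ltW B0).
have h3 : k * u ^+ 2 <= k * (B ^+ 2 * u ^+ 4).
  rewrite ler_wpM2l// -[leLHS]mul1r ler_pM ?ler01 ?exprn_ge0 ?(ltW u0)//.
    exact: exprn_ege1.
  by apply: ler_weXn2l.
have e18 : 2 ^+ 18 = 4 * 2 ^+ 16 :> R by rewrite -[18%N]/(2 + 16)%N exprD; congr (_ * _); ring.
have e16 : 64 <= 2 ^+ 16 :> R.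
  have -> : 64 = 2 ^+ 6 :> R by ring.
  by apply: ler_weXn2l; rewrite ?ler1n.
move: M1 h2 e16; rewrite e18; move: (2 ^+ 16) => P.
set W := k * (B ^+ 2 * u ^+ 4) in h3 *; set V := k * (T * B * u ^+ 4).
have W0 : 0 <= W by rewrite !mulr_ge0 ?exprn_ge0 ?(ltW u0) ?(ltW B0).
move=> M1 h2 e16.
have h4 : 64 * W <= P * W by rewrite ler_wpM2r.
have h5 : P * V <= P * W by rewrite ler_wpM2l// (le_trans _ e16).
lra.
Qed.

End Asymptotics.

(** * Assembly of the indistinguishability theorem *)

Section Main.
Context {R : realType}.

Lemma avg_GHE l m (F : {ffun bits l -> bits m} -> {ffun bits m -> bits l} -> R) :
  avg_GH F = avg (fun G => avg (F G)).
Proof.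
rewrite /avg_GH /avg invfM -mulrA; congr (_ * _).
by rewrite mulr_sumr; apply: eq_bigr => G _; rewrite mulr_sumr.
Qed.

Lemma accept_rho_CP w l m q (c : seq (instr w l m))
    (D : {ffun bits l -> R}) (G : bits l -> bits m) (H : bits m -> bits l)
    (nu : 'M[R[i]]_(2 ^ q)) (K : finType) (p : K -> R) (phi : K -> nat -> R[i]) :
  (forall a b, (a < 2 ^ q)%N -> (b < 2 ^ q)%N ->
     mxf nu a b = \sum_k (p k)%:C%C * (phi k a * conjc (phi k b))) ->
  accept_prob (circ_mat G H c) (input_state w l m (rho_CP D G H) nu) =
  \sum_k p k * \sum_y D y * avg (fun v => accket q c (phi k) G H (G y) v (H v)).
Proof.
move=> nuE.
rewrite (accept_prob_input _ (J := (bits l * bits m)%type)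
   (cf := fun j => D j.1 * (2 ^ m)%:R^-1)
   (kt := fun j => cp_ket (G j.1) j.2 (H j.2)) _ nuE); last first.
  move=> a b _ _; rewrite /rho_CP -(pair_bigA _ (fun y v => (D y * (2 ^ m)%:R^-1)%:C%C *
      (cp_ket (G y) v (H v) a * conjc (cp_ket (G y) v (H v) b))))/=.
  apply: eq_bigr => y _; rewrite mulr_sumr mulr_sumr; apply: eq_bigr => v _.
  rewrite (rmorphM (real_complex R)) -[RHS]mulrA; congr (_ * (_ * _)).
  by rewrite -(rmorph_nat (real_complex R)) -fmorphV.
apply: eq_bigr => k _; congr (_ * _).
rewrite -(pair_bigA _ (fun y v => D y * (2 ^ m)%:R^-1 *
   acc (circ_mat G H c *m inp l m q w (cp_ket (G y) v (H v)) (phi k))))/=.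
apply: eq_bigr => y _; rewrite /avg card_bits mulr_sumr mulr_sumr.
by apply: eq_bigr => v _; rewrite circ_mat_run mulrA.
Qed.

(** Completeness holds in every basis [th], so the average over [th] as well is still maximally
    mixed; this form is the endpoint of [reprogram_H]. *)
Lemma accept_max_mixed w l m q (c : seq (instr w l m))
    (G : bits l -> bits m) (H : bits m -> bits l)
    (nu : 'M[R[i]]_(2 ^ q)) (K : finType) (p : K -> R) (phi : K -> nat -> R[i]) :
  (forall a b, (a < 2 ^ q)%N -> (b < 2 ^ q)%N ->
     mxf nu a b = \sum_k (p k)%:C%C * (phi k a * conjc (phi k b))) ->
  accept_prob (circ_mat G H c) (input_state w l m (@max_mixed R l m) nu) =
  \sum_k p k * avg (fun th => avg (fun v => avg (fun h =>
    accket q c (phi k) G H th v h))).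
Proof.
move=> nuE.
pose cf : R := (2 ^ m)%:R^-1 * ((2 ^ m)%:R^-1 * (2 ^ l)%:R^-1).
rewrite (accept_prob_input _ (J := (bits m * (bits m * bits l))%type)
   (cf := fun _ => cf) (kt := fun j => cp_ket j.1 j.2.1 j.2.2) _ nuE); last first.
  move=> a b al bl; rewrite -mulr_sumr.
  rewrite -(pair_bigA _ (fun th (j : bits m * bits l) => cp_ket th j.1 j.2 a * conjc (cp_ket th j.1 j.2 b)))/=.
  rewrite (eq_bigr (fun _ => (a == b)%:R)); last first.
    move=> th _; rewrite -(pair_bigA _ (fun v h => cp_ket th v h a * conjc (cp_ket th v h b)))/=.
    exact: cp_ket_complete.
  rewrite sumr_const card_bits /max_mixed al andbT.
  have N0 n : (2 ^ n)%:R != 0 :> R by rewrite pnatr_eq0 -lt0n expn_gt0.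
  case: eqP => _; last by rewrite mul0rn mulr0.
  rewrite /cf -[X in _ = _ * X]mulr_natr mul1r -(rmorph_nat (real_complex R) (2 ^ m)).
  rewrite -rmorphM/= -(rmorph_nat (real_complex R) (2 ^ (m + l))) -fmorphV; congr (_%:C)%C.
  by rewrite expnD natrM; field; rewrite !N0.
apply: eq_bigr => k _; congr (_ * _).
rewrite -(pair_bigA _ (fun th (j : bits m * bits l) => cf *
   acc (circ_mat G H c *m inp l m q w (cp_ket th j.1 j.2) (phi k))))/=.
rewrite /avg !card_bits mulr_sumr; apply: eq_bigr => th _.
rewrite -(pair_bigA _ (fun v h => cf *
   acc (circ_mat G H c *m inp l m q w (cp_ket th v h) (phi k))))/=.
rewrite mulr_sumr mulr_sumr; apply: eq_bigr => v _.
rewrite !mulr_sumr; apply: eq_bigr => h _.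
by rewrite circ_mat_run /cf -!mulrA.
Qed.

End Main.

Theorem mainTheorem6 (R : realType)
  (m : nat -> nat) (hm_gt : forall l, (l < m l)%N) (hm_poly : poly_bounded m)
  (D : forall l, {ffun bits l -> R}) (hD : PF_UNP D)
  (w : nat -> nat) (circ : forall l, seq (instr (w l) l (m l)))
  (hw : poly_bounded w) (hsize : poly_bounded (fun l => size (circ l)))
  (hwf : forall l, circ_wf (circ l))
  (q : nat -> nat) (hq : poly_bounded q)
  (hqw : forall l, (m l + l + q l <= w l)%N)
  (nu : forall l, 'M[R[i]]_(2 ^ q l)) (hnu : forall l, density (nu l)) :
  negligible (fun l =>
    avg_GH (fun G H =>
      `| accept_prob (circ_mat G H (circ l))
           (@input_state R (w l) l (m l) (q l) (rho_CP (D l) G H) (nu l))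
         - accept_prob (circ_mat G H (circ l))
           (@input_state R (w l) l (m l) (q l) (@max_mixed R l (m l)) (nu l)) |)).
Proof.
have [D0 [D1 [eps [eps0 Deps]]]] := hD.
(* The first summand is the min-entropy bound [2] to the power [- n ^ eps], the second dominates
   [(7 / 8) ^+ m n] because [n < m n]. Their sum majorizes both. *)
pose kap n : R := expR (- (ln 2 * n%:R `^ eps)) + (7 / 8) ^+ n.
have ln20 : 0 < ln (2 : R) by rewrite ln_gt0// ltr1n.
have g0 n : 0 <= (7 / 8) ^+ n :> R by rewrite exprn_ge0// divr_ge0 ?ler0n.
apply: (@negligible_of_tradeoff _ (fun l => size (circ l)) kap) => //.
- apply: negligibleD; first exact: negligible_expR_powR.
  by apply: negligible_geometric; apply/andP; split; lra.
- by move=> n; rewrite addr_ge0 ?expR_ge0.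
move=> l eta eta' e0 e0'.
have Dk y : D l y <= kap l.
  apply: le_trans (Deps l y) _; rewrite /powR pnatr_eq0/= -/(powR _ _).
  by rewrite /kap mulNr mulrC lerDl.
have gk : (7 / 8) ^+ m l <= kap l.
  apply: ler_wpDl; first exact: expR_ge0.
  by apply: ler_wiXn2l; [lra|lra|exact: ltnW].
have [p [f [p0 p1 f1 nuE]]] := density_spectral (hnu l).
pose phi k (z : nat) : R[i] := if insub z is Some a then f k a 0 else 0.
have phiE k (z : 'I_(2 ^ q l)) : phi k z = f k z 0 by rewrite /phi valK.
have phi1 k : \sum_(z < 2 ^ q l) sqn (phi k z) = 1.
  by rewrite -(f1 k); apply: eq_bigr => z _; rewrite phiE.
have mxfE a b : (a < 2 ^ q l)%N -> (b < 2 ^ q l)%N ->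
    mxf (nu l) a b = \sum_k (p k)%:C%C * (phi k a * conjc (phi k b)).
  move=> al bl; rewrite -[a]/(val (Ordinal al)) -[b]/(val (Ordinal bl)).
  by rewrite /mxf !valK nuE; apply: eq_bigr => k _; rewrite !phiE.
rewrite avg_GHE; set Bd := 2 * _.
pose d k (G : {ffun bits l -> bits (m l)}) (H : {ffun bits (m l) -> bits l}) : R :=
  \sum_y D l y * avg (fun v => accket (q l) (circ l) (phi k) G H (G y) v (H v)) -
  avg (fun th => avg (fun v => avg (fun h => accket (q l) (circ l) (phi k) G H th v h))).
(* By convexity of the absolute value it is enough to treat each eigenvector of the auxiliary state;
   the bound is the same for all of them and the [p k] sum to one. *)
apply: (@le_trans _ _ (\sum_k p k * avg (fun G => avg (fun H => `|d k G H|)))).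
  under [leRHS]eq_bigr do rewrite -avgZ.
  rewrite -avg_sum; apply: ler_avg => G.
  under [leRHS]eq_bigr do rewrite -avgZ.
  rewrite -avg_sum; apply: ler_avg => H.
  rewrite (accept_rho_CP _ _ _ _ mxfE) (accept_max_mixed _ _ _ mxfE).
  rewrite -sumrB; apply: le_trans (ler_norm_sum _ _ _) _; apply: ler_sum => k _.
  by rewrite -mulrBr normrM ger0_norm.
rewrite -[leRHS]mul1r -p1 mulr_suml; apply: ler_sum => k _.
apply: ler_wpM2l => //; exact: distinguishing_bound.
Qed.
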